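(* Let $T>0$, $n,k\ge1$, let $A,\varphi_j,\psi_j$ ($j=1,\dots,k$) be continuous $(n\times n)$-matrix functions on $[0,T]$, and consider, for $f\in C([0,T],\mathbb R^n)$ and $d\in\mathbb R^n$, the multipoint problem $$\frac{dx}{dt}=A(t)x+\sum_{j=1}^k\int_0^T\varphi_j(t)\psi_j(\tau)x(\tau)\,d\tau+f(t),\quad t\in(0,T),\qquad \sum_{i}B_i x(t_i)=d,$$ where the sum in the second condition is over finitely many given points $t_i$ of $[0,T]$, including $0$ and $T$, with given constant $(n\times n)$ matrices $B_i$. This problem is well-posed if and only if for every regular partition $\Delta_m\in\sigma(k,[0,T])$ the matrix $Q_\ast(\Delta_m):\mathbb R^{nm}\to\mathbb R^{nm}$ is invertible.
   Context: Norms: $\|x\|=\max_i|x_i|$ for vectors, $\|x\|_1=\max_{t\in[0,T]}\|x(t)\|$ for $x\in C([0,T],\mathbb R^n)$. A solution of the problem is a function $x:[0,T]\to\mathbb R^n$ that is continuous on $[0,T]$, continuously differentiable on $(0,T)$, and satisfies the integro-differential equation on $(0,T)$ and the multipoint condition. The problem is well-posed if for every pair $(f,d)$ with $f\in C([0,T],\mathbb R^n)$, $d\in\mathbb R^n$, it has a unique solution $x$, and $\|x\|_1\le K\max(\|f\|_1,\|d\|)$ with a constant $K$ independent of $f$ and $d$. Partitions: a partition $\Delta_m$ is given by points $0=t_0<t_1<\dots<t_m=T$ (so $[0,T)=\bigcup_{r=1}^m[t_{r-1},t_r)$) that include all the points occurring in the multipoint condition; after relabelling, the multipoint condition is written as $\sum_{i=0}^mB_ix(t_i)=d$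 with $B_i=0$ at the partition points that do not occur in the original condition. For $r=1,\dots,m$ let $X_r(t)$ be a fundamental matrix of $dx/dt=A(t)x$ on $[t_{r-1},t_r]$ (the quantities below do not depend on its choice). Matrix $G(\Delta_m)=(G_{p,l}(\Delta_m))_{p,l=1}^k$, with $(n\times n)$ blocks $$G_{p,l}(\Delta_m)=\sum_{r=1}^m\int_{t_{r-1}}^{t_r}\psi_p(\tau)X_r(\tau)\int_{t_{r-1}}^{\tau}X_r^{-1}(\tau_1)\varphi_l(\tau_1)\,d\tau_1\,d\tau .$$ $\Delta_m$ is called regular if the $(nk\times nk)$ matrix $I-G(\Delta_m)$ is invertible; $\sigma(k,[0,T])$ denotes the set of regular partitions. For regular $\Delta_m$ write $[I-G(\Delta_m)]^{-1}=(M_{j,p}(\Delta_m))_{j,p=1}^k$ with $(n\times n)$ blocks. For $p=1,\dots,k$, $r=1,\dots,m$: $$V_{p,r}(\Delta_m)=\int_{t_{r-1}}^{t_r}\psi_p(\tau)X_r(\tau)\int_{t_{r-1}}^{\tau}X_r^{-1}(\tau_1)A(\tau_1)\,d\tau_1\,d\tau+\sum_{s=1}^m\sum_{j=1}^k\int_{t_{s-1}}^{t_s}\psi_p(\tau)X_s(\tau)\int_{t_{s-1}}^{\tau}X_s^{-1}(\tau_1)\varphi_j(\tau_1)\,d\tau_1\,d\tau\int_{t_{r-1}}^{t_r}\psi_j(\tau_2)\,d\tau_2 .$$ For $r,i=1,\dots,m$ (with $\delta_{ri}$ the Kronecker symbol): $$D_{r,i}(\Delta_m)=\sum_{j=1}^kX_r(t_r)\int_{t_{r-1}}^{t_r}X_r^{-1}(\tau)\varphi_j(\tau)\,d\tau\Big[\sum_{p=1}^kM_{j,p}(\Delta_m)V_{p,i}(\Delta_m)+\int_{t_{i-1}}^{t_i}\psi_j(\tau_1)\,d\tau_1\Big]+\delta_{ri}X_r(t_r)\int_{t_{r-1}}^{t_r}X_r^{-1}(\tau)A(\tau)\,d\tau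 .$$ $Q_\ast(\Delta_m)$ is the $(nm\times nm)$ matrix of the linear map sending $\lambda=(\lambda_1,\dots,\lambda_m)\in\mathbb R^{nm}$ ($\lambda_r\in\mathbb R^n$) to the vector whose first $\mathbb R^n$-component is $$\sum_{i=0}^{m-2}[B_i+B_mD_{m,i+1}(\Delta_m)]\lambda_{i+1}+[B_{m-1}+B_m+B_mD_{m,m}(\Delta_m)]\lambda_m$$ and whose $(p+1)$-th component, $p=1,\dots,m-1$, is $$[I+D_{p,p}(\Delta_m)]\lambda_p-[I-D_{p,p+1}(\Delta_m)]\lambda_{p+1}+\sum_{i\ne p,\,i\neq p+1}D_{p,i}(\Delta_m)\lambda_i .$$ *)

(* Defs.v *)
From HB Require Import structures.
From mathcomp Require Export all_boot all_order all_algebra.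
From mathcomp Require Export all_classical all_reals all_analysis.
Export Order.TTheory GRing.Theory Num.Theory numFieldNormedType.Exports.

Set Implicit Arguments.
Unset Strict Implicit.
Unset Printing Implicit Defensive.

Local Open Scope classical_set_scope.
Local Open Scope ring_scope.

Section Norm_and_integral.
Context {R : realType}.

(* The norm of ['M[R]_(p, q)] is the maximum of the absolute values of the
   entries.  On functions continuous on [0, T] the supremum is a maximum. *)
Definition norm1 {n} (T : R) (x : R -> 'cV[R]_n) : R :=
  sup [set `|x t| | t in `[0, T]].

Definition mxint {p q} (a b : R) (F : R -> 'M[R]_(p, q)) : 'M[R]_(p, q) :=
  \matrix_(i, j) \int[lebesgue_measure]_(t in `[a, b]) F t i j.

End Norm_and_integral.

Section Multipoint_problem.
Context {R : realType} {n k q : nat} (T : R).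
Context (A : R -> 'M[R]_n) (phi psi : 'I_k -> R -> 'M[R]_n).
Context (s : 'I_q -> R) (B : 'I_q -> 'M[R]_n).

(* Only the values of x on [0, T] matter. *)
Definition is_solution (f : R -> 'cV[R]_n) (d : 'cV[R]_n)
    (x : R -> 'cV[R]_n) : Prop :=
  [/\ {within `[0, T], continuous x},
      forall t : R, 0 < t < T ->
        derivable x t 1 /\ {for t, continuous (derive1 x)},
      forall t : R, 0 < t < T ->
        derive1 x t = A t *m x t
          + \sum_(j < k) mxint 0 T (fun tau => phi j t *m psi j tau *m x tau)
          + f t
    & \sum_(l < q) B l *m x (s l) = d].

Definition well_posed : Prop :=
  exists K : R, forall (f : R -> 'cV[R]_n) (d : 'cV[R]_n),
    {within `[0, T], continuous f} ->
    exists x, [/\ is_solution f d x,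
      forall y, is_solution f d y -> forall t : R, 0 <= t <= T -> y t = x t
      & norm1 T x <= K * Num.max (norm1 T f) `|d|].

End Multipoint_problem.

(* A partition 0 = t_0 < ... < t_m = T containing all the points s_l of the
   multipoint condition; only t_0, ..., t_m are relevant. *)
Definition is_partition {R : realType} {q} (T : R) (s : 'I_q -> R)
    (m : nat) (t : nat -> R) : Prop :=
  [/\ t 0%N = 0, t m = T,
      forall r, (r < m)%N -> t r < t r.+1
    & forall l, exists2 i, (i <= m)%N & t i = s l].

Definition is_fundamental {R : realType} {n} (A : R -> 'M[R]_n) (a b : R)
    (X : R -> 'M[R]_n) : Prop :=
  [/\ {within `[a, b], continuous X},
      forall t : R, a < t < b -> derivable X t 1 /\ derive1 X t = A t *m X t
    & forall t : R, a <= t <= b -> X t \in unitmx].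

(* The subintervals are numbered from 0: the r-th one is [t_r, t_{r+1}], with
   fundamental matrix X r, for r < m. *)
Section Parametrization.
Context {R : realType} {n k q : nat}.
Context (A : R -> 'M[R]_n) (phi psi : 'I_k -> R -> 'M[R]_n).
Context (s : 'I_q -> R) (B : 'I_q -> 'M[R]_n).
Context (m : nat) (t : nat -> R) (X : nat -> R -> 'M[R]_n).

Definition XintX (r : nat) (F : R -> 'M[R]_n) (tau : R) : 'M[R]_n :=
  X r tau *m mxint (t r) tau (fun tau1 => invmx (X r tau1) *m F tau1).

Definition Gblock (p l : 'I_k) : 'M[R]_n :=
  \sum_(r < m)
    mxint (t r) (t r.+1) (fun tau => psi p tau *m XintX r (phi l) tau).

Definition Gmx := \mxblock_(p < k, l < k) Gblock p l.

Definition regular : Prop := 1%:M - Gmx \in unitmx.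

Definition Mblock (j p : 'I_k) : 'M[R]_n :=
  submxblock (invmx (1%:M - Gmx)) j p.

Definition Vmx (p : 'I_k) (r : nat) : 'M[R]_n :=
  mxint (t r) (t r.+1) (fun tau => psi p tau *m XintX r A tau)
  + \sum_(h < m) \sum_(j < k)
      mxint (t h) (t h.+1) (fun tau => psi p tau *m XintX h (phi j) tau)
        *m mxint (t r) (t r.+1) (psi j).

Definition Dmx (r i : nat) : 'M[R]_n :=
  \sum_(j < k) XintX r (phi j) (t r.+1)
      *m (\sum_(p < k) Mblock j p *m Vmx p i + mxint (t i) (t i.+1) (psi j))
  + (r == i)%:R *: XintX r A (t r.+1).

(* Coefficient at t_i of the relabelled condition \sum_(i <= m) B_i x(t_i) = d;
   it is 0 when t_i is not one of the points s_l. *)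
Definition Bpart (i : nat) : 'M[R]_n := \sum_(l < q | s l == t i) B l.

(* With p and i numbered from 0, block row p > 0 expresses continuity at t_p,
   between the subintervals p.-1 and p. *)
Definition Qblock (p i : 'I_m) : 'M[R]_n :=
  if p == 0%N :> nat then
    if i == m.-1 :> nat then Bpart m.-1 + Bpart m + Bpart m *m Dmx m.-1 m.-1
    else Bpart i + Bpart m *m Dmx m.-1 i
  else if i == p.-1 :> nat then 1%:M + Dmx p.-1 i
  else if i == p then - (1%:M - Dmx p.-1 i)
  else Dmx p.-1 i.

Definition Qmx := \mxblock_(p < m, i < m) Qblock p i.

End Parametrization.

(* Main.v *)
Require Import Defs.
From mathcomp Require Import ring lra.

Set Implicit Arguments.
Unset Strict Implicit.
Unset Printing Implicit Defensive.
Local Open Scope classical_set_scope.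
Local Open Scope ring_scope.

(** On the piece [t_r, t_{r+1}] a solution x is determined by its initial value
    lambda_r = x(t_r) and the moments c_j = \int_0^T psi_j x through Duhamel's formula
    x = lambda_r + X_r \int X_r^-1 (A lambda_r + sum_j phi_j c_j + f).  Regularity of the
    partition lets the moment equations be solved for c in terms of lambda; the continuity
    conditions at the t_r and the multipoint condition then become Q lambda = rhs(f, d).
    A kernel vector of Q therefore glues to a nonzero solution of the homogeneous problem.
    Conversely, on a sufficiently fine partition fundamental matrices exist by Picard
    iteration, G is small so that the partition is regular, and invertibility of Q for this
    single partition already gives existence, uniqueness and the a priori estimate. *)

(** Why [Dmx] contains [Mblock] times [Vmx] plus the integral of [psi]: let [Psi] be the integrals
    of [psi] over the pieces and [W] the first term of [Vmx]. The moments of [x] itself satisfy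
    [c = (Psi + W) lambda + G c + e], with [e] coming from [f]. As [(I - G)^-1 = I + (I - G)^-1 G],
    this solves to [c = Psi lambda + (I - G)^-1 (V lambda + e)] with [V = W + G Psi]. Short steps
    take the place of Gronwall's inequality: if [n M (t_{r+1} - t_r) <= 1/2], where [M] bounds [A],
    half of the maximum of a solution is absorbed by the left-hand side. This gives uniqueness on a
    piece, and a bound on Duhamel terms that does not involve [X]; the latter matters because the
    mesh has to be chosen before any fundamental matrix is constructed. Derivatives are available
    only in open intervals, and values outside [[0, T]] are arbitrary. Pieces are therefore joined
    and compared through integral equations, and differentiability of the solution is recovered only
    after gluing. *)

Section Matrix_norm.
Context {R : realType}.

Lemma mx_norm_leP p q (M : 'M[R]_(p, q)) c :
  0 <= c -> `|M| <= c <-> forall i j, `|M i j| <= c.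
Proof.
move=> c0; rewrite {1}/Num.Def.normr/= mx_normrE; split=> [h i j|h].
  exact: le_trans (le_bigmax _ (fun ij => `|M ij.1 ij.2|) (i, j)) h.
by apply: bigmax_le => // -[i j] _; exact: h.
Qed.

Lemma mx_norm_entry p q (M : 'M[R]_(p, q)) i j : `|M i j| <= `|M|.
Proof. by have /mx_norm_leP := lexx `|M|; exact. Qed.

(** The maximum of the entries is not submultiplicative: an entry of the product has [q] terms. This
    is the origin of the factor [n%:R] in the smallness conditions below. *)
Lemma mx_norm_mul p q r (M : 'M[R]_(p, q)) (N : 'M[R]_(q, r)) :
  `|M *m N| <= q%:R * `|M| * `|N|.
Proof.
apply/mx_norm_leP => [|i j]; first by rewrite !mulr_ge0.
rewrite mxE (le_trans (ler_norm_sum _ _ _))//.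
rewrite (@le_trans _ _ (\sum_(l < q) `|M| * `|N|))//.
  by apply: ler_sum => l _; rewrite normrM ler_pM// mx_norm_entry.
by rewrite sumr_const card_ord -mulrA mulr_natl.
Qed.

End Matrix_norm.

(** * Continuity on a closed interval under matrix operations *)

Section Within_continuous.
Context {R : realType}.
Implicit Types a b : R.

Lemma mx_continuousP (U : topologicalType) p q (F : U -> 'M[R]_(p, q)) (x : U) :
  {for x, continuous F} <-> forall i j, {for x, continuous (fun t => F t i j)}.
Proof.
split=> [h i j|h].
  by apply: (@continuous_comp _ _ _ F (fun M : 'M[R]_(p, q) => M i j));
    [exact: h | exact: coord_continuous].
apply/cvgrPdist_le => /= e e0; near=> y.
apply/mx_norm_leP => [|i j]; first exact: ltW.
rewrite !mxE; move: i j; near: y.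
apply: filter_forall => i; apply: filter_forall => j.
by move/cvgrPdist_le: (h i j); exact.
Unshelve. all: by end_near. Qed.

Lemma mx_within_continuousP a b p q (F : R -> 'M[R]_(p, q)) :
  {within `[a, b], continuous F} <->
  forall i j, {within `[a, b], continuous (fun t => F t i j)}.
Proof.
split=> [h i j x|h x]; first by move: i j; apply/mx_continuousP; exact: h.
by apply/mx_continuousP => i j; exact: h.
Qed.

Lemma within_continuousW a b a' b' (U : topologicalType) (F : R -> U) :
  a <= a' -> b' <= b ->
  {within `[a, b], continuous F} -> {within `[a', b'], continuous F}.
Proof.
move=> aa bb; apply: continuous_subspaceW => x/=; rewrite !in_itv/=.
by move=> /andP[/(le_trans aa)-> /le_trans->].
Qed.

Lemma eq_within_continuous a b (U : topologicalType) (F G : R -> U) :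
  (forall t, a <= t <= b -> F t = G t) ->
  {within `[a, b], continuous F} -> {within `[a, b], continuous G}.
Proof.
move=> e; apply: subspace_eq_continuous => x; rewrite inE/= in_itv/= => h.
exact: e.
Qed.

Lemma within_continuous_cst a b (U : topologicalType) (c : U) :
  {within `[a, b], continuous (fun=> c)}.
Proof. by move=> x; exact: cvg_cst. Qed.

Lemma within_continuous_mxD a b p q (F G : R -> 'M[R]_(p, q)) :
  {within `[a, b], continuous F} -> {within `[a, b], continuous G} ->
  {within `[a, b], continuous (fun t => F t + G t)}.
Proof. by move=> cF cG x; apply: cvgD; [exact: cF|exact: cG]. Qed.

Lemma within_continuous_mxN a b p q (F : R -> 'M[R]_(p, q)) :
  {within `[a, b], continuous F} -> {within `[a, b], continuous (fun t => - F t)}.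
Proof. by move=> cF x; apply: cvgN; exact: cF. Qed.

Lemma within_continuous_sum a b (V : normedModType R) (I : Type) (r : seq I)
    (F : I -> R -> V) :
  (forall i, {within `[a, b], continuous (F i)}) ->
  {within `[a, b], continuous (fun t => \sum_(i <- r) F i t)}.
Proof.
move=> h; elim: r => [|i r IH].
  apply: (@eq_within_continuous _ _ _ (fun=> 0)) => [t _|].
    by rewrite big_nil.
  exact: within_continuous_cst.
apply: (@eq_within_continuous _ _ _ (fun t => F i t + \sum_(j <- r) F j t)).
  by move=> t _; rewrite big_cons.
by move=> x; apply: cvgD; [exact: h|exact: IH].
Qed.

Lemma within_continuous_prod a b (I : Type) (r : seq I) (F : I -> R -> R) :
  (forall i, {within `[a, b], continuous (F i)}) ->
  {within `[a, b], continuous (fun t => \prod_(i <- r) F i t)}.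
Proof.
move=> h; elim: r => [|i r IH].
  apply: (@eq_within_continuous a b R (fun=> 1)) => [t _|].
    by rewrite big_nil.
  exact: within_continuous_cst.
apply: (@eq_within_continuous a b R (fun t => F i t * \prod_(j <- r) F j t)).
  by move=> t _; rewrite big_cons.
by move=> x; apply: cvgM; [exact: h|exact: IH].
Qed.

Lemma within_continuous_mulmx a b p q r (F : R -> 'M[R]_(p, q))
    (G : R -> 'M[R]_(q, r)) :
  {within `[a, b], continuous F} -> {within `[a, b], continuous G} ->
  {within `[a, b], continuous (fun t => F t *m G t)}.
Proof.
move=> /mx_within_continuousP cF /mx_within_continuousP cG.
apply/mx_within_continuousP => i j.
apply: (@eq_within_continuous a b R (fun t => \sum_l F t i l * G t l j)).
  by move=> t _; rewrite mxE.
by apply: within_continuous_sum => l x; apply: cvgM; [exact: cF|exact: cG].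
Qed.

Lemma within_continuous_det a b p (F : R -> 'M[R]_p) :
  {within `[a, b], continuous F} -> {within `[a, b], continuous (fun t => \det (F t))}.
Proof.
move=> /mx_within_continuousP cF; rewrite /determinant.
apply: within_continuous_sum => s x; apply: cvgM; first exact: cvg_cst.
by apply: within_continuous_prod => i; exact: cF.
Qed.

(** Cramer's rule: the inverse is the adjugate over the determinant, so its entries are quotients of
    polynomials in the entries of [F]. *)
Lemma within_continuous_invmx a b p (F : R -> 'M[R]_p) :
  (forall t, a <= t <= b -> F t \in unitmx) ->
  {within `[a, b], continuous F} -> {within `[a, b], continuous (fun t => invmx (F t))}.
Proof.
move=> uF cF.
apply: (@eq_within_continuous _ _ _ (fun t => (\det (F t))^-1 *: \adj (F t))).
  by move=> t /uF; rewrite /invmx => ->.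
apply/mx_within_continuousP => i j.
apply: (@eq_within_continuous a b R
    (fun t => (\det (F t))^-1 * ((-1) ^+ (j + i) * \det (row' j (col' i (F t)))))).
  by move=> t _; rewrite !mxE.
have cdet := within_continuous_det cF.
(* The determinant is known to be nonzero only on [[a, b]], so continuity is checked at the points
   of that interval. *)
apply/subspace_continuousP => x xab; apply: cvgM.
  apply: cvgV; last by move: x xab; apply/subspace_continuousP.
  by rewrite -unitfE -unitmxE uF//; move: xab; rewrite /= in_itv.
apply: cvgM; first exact: cvg_cst.
move: x xab; apply/subspace_continuousP; apply: within_continuous_det.
apply/mx_within_continuousP => k l.
apply: (@eq_within_continuous a b R (fun t => F t (lift j k) (lift i l))).
  by move=> t _; rewrite !mxE.
by move/mx_within_continuousP: cF; exact.
Qed.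

End Within_continuous.

(** * Entrywise integration and differentiation of matrix functions *)

Section Matrix_integral.
Context {R : realType}.
Implicit Types a b c : R.
Local Notation mu := (@lebesgue_measure R).

Lemma within_continuous_integrable a b (f : R -> R) :
  {within `[a, b], continuous f} -> mu.-integrable `[a, b] (EFin \o f).
Proof.
by move=> cf; apply: continuous_compact_integrable => //; exact: segment_compact.
Qed.

Lemma mx_entry_integrable a b p q (F : R -> 'M[R]_(p, q)) i j :
  {within `[a, b], continuous F} -> mu.-integrable `[a, b] (EFin \o (fun t => F t i j)).
Proof.
by move=> /mx_within_continuousP cF; exact: within_continuous_integrable.
Qed.

Lemma eq_mxint a b p q (F G : R -> 'M[R]_(p, q)) :
  (forall t, a <= t <= b -> F t = G t) -> mxint a b F = mxint a b G.
Proof.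
move=> e; apply/matrixP => i j; rewrite !mxE; apply: eq_Rintegral => x.
by rewrite inE/= in_itv/= => /e->.
Qed.

Lemma mxint_point a p q (F : R -> 'M[R]_(p, q)) : mxint a a F = 0.
Proof.
by apply/matrixP => i j; rewrite !mxE set_itv1 Rintegral_set1.
Qed.

Lemma mxint_cst0 a b p q : mxint a b (fun=> 0 : 'M[R]_(p, q)) = 0.
Proof.
by apply/matrixP => i j; rewrite !mxE -[RHS](mul0r (fine (mu `[a, b]))) -Rintegral_cst.
Qed.

Lemma mxintD a b p q (F G : R -> 'M[R]_(p, q)) :
  {within `[a, b], continuous F} -> {within `[a, b], continuous G} ->
  mxint a b (fun t => F t + G t) = mxint a b F + mxint a b G.
Proof.
move=> cF cG; apply/matrixP => i j; rewrite !mxE.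
rewrite -RintegralD//; try exact: mx_entry_integrable.
by apply: eq_Rintegral => t _; rewrite mxE.
Qed.

Lemma mxint_sum a b p q (I : Type) (r : seq I) (F : I -> R -> 'M[R]_(p, q)) :
  (forall i, {within `[a, b], continuous (F i)}) ->
  mxint a b (fun t => \sum_(i <- r) F i t) = \sum_(i <- r) mxint a b (F i).
Proof.
move=> cF; elim: r => [|i r IH].
  rewrite big_nil -[RHS](mxint_cst0 a b); apply: eq_mxint => t _.
  by rewrite big_nil.
rewrite big_cons -IH -mxintD//; last exact: within_continuous_sum.
by apply: eq_mxint => t _; rewrite big_cons.
Qed.

Lemma mxintZ a b p q c (F : R -> 'M[R]_(p, q)) :
  {within `[a, b], continuous F} ->
  mxint a b (fun t => c *: F t) = c *: mxint a b F.
Proof.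
move=> cF; apply/matrixP => i j; rewrite !mxE.
rewrite -RintegralZl//; last exact: mx_entry_integrable.
by apply: eq_Rintegral => t _; rewrite mxE.
Qed.

Lemma mxintN a b p q (F : R -> 'M[R]_(p, q)) :
  {within `[a, b], continuous F} -> mxint a b (fun t => - F t) = - mxint a b F.
Proof.
move=> cF; rewrite -scaleN1r -mxintZ//.
by apply: eq_mxint => t _; rewrite scaleN1r.
Qed.

Lemma mxintMr a b p q r (F : R -> 'M[R]_(p, q)) (C : 'M[R]_(q, r)) :
  {within `[a, b], continuous F} ->
  mxint a b (fun t => F t *m C) = mxint a b F *m C.
Proof.
move=> cF; apply/matrixP => i j; rewrite !mxE.
(* 1 x 1 matrices, so that [mxint_sum] applies *)
have cE l : {within `[a, b], continuous (fun t => (F t i l * C l j)%:M : 'M[R]_1)}.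
  apply/mx_within_continuousP => i' j'.
  apply: (@eq_within_continuous _ a b R (fun t => F t i l * (C l j *+ (i' == j')))).
    by move=> t _; rewrite mxE mulrnAr.
  move=> x; apply: cvgM; last exact: cvg_cst.
  by move/mx_within_continuousP: cF; apply.
have := mxint_sum (index_enum 'I_q) cE => /matrixP/(_ 0 0).
rewrite !mxE summxE => h.
transitivity (\int[mu]_(t in `[a, b]) (\sum_l (F t i l * C l j)%:M : 'M[R]_1) 0 0).
  apply: eq_Rintegral => t _; rewrite mxE summxE; apply: eq_bigr => l _.
  by rewrite mxE mulr1n.
rewrite h; apply: eq_bigr => l _; rewrite !mxE -RintegralZr//.
  by apply: eq_Rintegral => t _; rewrite mxE mulr1n.
exact: mx_entry_integrable.
Qed.

Lemma mxint_tr a b p q (F : R -> 'M[R]_(p, q)) :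
  mxint a b (fun t => (F t)^T) = (mxint a b F)^T.
Proof.
apply/matrixP => i j; rewrite !mxE; apply: eq_Rintegral => t _; exact: mxE.
Qed.

Lemma mxintMl a b p q r (C : 'M[R]_(p, q)) (F : R -> 'M[R]_(q, r)) :
  {within `[a, b], continuous F} ->
  mxint a b (fun u => C *m F u) = C *m mxint a b F.
Proof.
move=> cF; apply: trmx_inj; rewrite trmx_mul -!mxint_tr -mxintMr.
  by apply: eq_mxint => u _; rewrite trmx_mul.
apply/mx_within_continuousP => i j.
apply: (@eq_within_continuous _ a b R (fun u => F u j i)) => [u _|].
  by rewrite mxE.
by move/mx_within_continuousP: cF; apply.
Qed.

Lemma mxint_cat a b c p q (F : R -> 'M[R]_(p, q)) :
  a <= b <= c -> {within `[a, c], continuous F} ->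
  mxint a c F = mxint a b F + mxint b c F.
Proof.
move=> /andP[ab bc] cF; apply/matrixP => i j; rewrite !mxE.
apply/eqP; rewrite addrC -subr_eq; apply/eqP.
rewrite Rintegral_itvB ?bnd_simp//; last exact: mx_entry_integrable.
rewrite Rintegral_itv_obnd_cbnd//.
apply: integrableS (mx_entry_integrable i j cF) => //.
by apply: subset_itv; rewrite bnd_simp.
Qed.

Lemma mxint_norm_le a b p q (F : R -> 'M[R]_(p, q)) c :
  a <= b -> 0 <= c -> {within `[a, b], continuous F} ->
  (forall t, a <= t <= b -> `|F t| <= c) -> `|mxint a b F| <= c * (b - a).
Proof.
move=> ab c0 cF Fc; apply/mx_norm_leP => [|i j].
  by rewrite mulr_ge0// subr_ge0.
rewrite mxE (le_trans (le_normr_Rintegral _ _))//; first exact: mx_entry_integrable.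
have -> : c * (b - a) = \int[mu]_(t in `[a, b]) c.
  rewrite Rintegral_cst//= lebesgue_measure_itv/= lte_fin.
  by case: ltgtP ab => //= ->; rewrite subrr.
apply: le_Rintegral => //.
- exact: (integrable_norm (mx_entry_integrable i j cF)).
- exact: within_continuous_integrable (@within_continuous_cst _ a b _ c).
- move=> t; rewrite /= in_itv/= => /Fc; apply: le_trans; exact: mx_norm_entry.
Qed.

Lemma mxint_continuous a b p q (F : R -> 'M[R]_(p, q)) :
  a <= b -> {within `[a, b], continuous F} ->
  {within `[a, b], continuous (fun t => mxint a t F)}.
Proof.
move=> ab cF; apply/mx_within_continuousP => i j.
have := parameterized_integral_continuous ab (mx_entry_integrable i j cF).
by apply: eq_within_continuous => t _; rewrite mxE.
Qed.

Lemma within_continuous_interior a b p q (F : R -> 'M[R]_(p, q)) t :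
  {within `[a, b], continuous F} -> a < t < b -> {for t, continuous F}.
Proof.
move=> cF /[dup] /andP[/lt_trans ab /ab {}ab] tab.
by apply: (within_continuous_continuous ab cF); rewrite in_itv.
Qed.

Lemma mxint_derivative a b p q (F : R -> 'M[R]_(p, q)) t :
  {within `[a, b], continuous F} -> a < t < b ->
  derivable (fun t => mxint a t F) t 1 /\ derive1 (fun t => mxint a t F) t = F t.
Proof.
move=> cF /[dup] tab /andP[at_ tb].
have H i j : derivable (fun t => mxint a t F i j) t 1 /\
   derive1 (fun t => mxint a t F i j) t = F t i j.
  under eq_fun do rewrite mxE.
  apply: (continuous_FTC1_closed tb (mx_entry_integrable i j cF) at_).
  by move: i j; apply/mx_continuousP; exact: within_continuous_interior cF tab.
have d : derivable (fun t => mxint a t F) t 1.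
  by apply/derivable_mxP => i j; exact: (H i j).1.
split=> //; rewrite derive1E derive_mx//.
by apply/matrixP => i j; rewrite mxE -derive1E; exact: (H i j).2.
Qed.

(** Derivatives are given only inside the interval; continuity of [u] at the ends carries the
    identity to the closed interval. The integral form of a solution and Duhamel's formula both rest
    on it. *)
Lemma mxint_FTC2 a b p q (u g : R -> 'M[R]_(p, q)) :
  {within `[a, b], continuous u} -> {within `[a, b], continuous g} ->
  (forall t, a < t < b -> derivable u t 1 /\ derive1 u t = g t) ->
  forall t, a <= t <= b -> u t = u a + mxint a t g.
Proof.
move=> cu cg du t /andP[]; rewrite le_eqVlt => /predU1P[<- _|at_ tb].
  by rewrite mxint_point addr0.
apply/matrixP => i j; rewrite !mxE.
have cu' := within_continuousW (lexx a) tb cu.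
have cg' := within_continuousW (lexx a) tb cg.
rewrite /Rintegral (@continuous_FTC2 _ _ (fun s => u s i j))//=.
- by rewrite addrC subrK.
- by move/mx_within_continuousP: cg'; exact.
- move/mx_within_continuousP: cu' => /(_ i j) /(continuous_within_itvP _ at_)[_ ? ?].
  split=> // x; rewrite in_itv/= => /andP[ax xt].
  have [|+ _] := du x; first by rewrite ax (lt_le_trans xt).
  by move=> /derivable_mxP; exact.
- move=> x; rewrite in_itv/= => /andP[ax xt].
  have [|dx <-] := du x; first by rewrite ax (lt_le_trans xt).
  by rewrite !derive1E derive_mx// mxE.
Qed.

Lemma derivative_mulmx p q r (F : R -> 'M[R]_(p, q)) (G : R -> 'M[R]_(q, r)) t :
  derivable F t 1 -> derivable G t 1 ->
  derivable (fun s => F s *m G s) t 1 /\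
  derive1 (fun s => F s *m G s) t = derive1 F t *m G t + F t *m derive1 G t.
Proof.
move=> dF dG; have /derivable_mxP eF := dF; have /derivable_mxP eG := dG.
have H i j : is_derive t 1 (fun s => (F s *m G s) i j)
    ((derive1 F t *m G t + F t *m derive1 G t) i j).
  have -> : (fun s => (F s *m G s) i j) = \sum_l ((fun s => F s i l) * (fun s => G s l j)).
    by apply/funext => s; rewrite mxE fct_sumE.
  have h l : is_derive t 1 ((fun s => F s i l) * (fun s => G s l j))
      (F t i l *: 'D_1 (fun s => G s l j) t + G t l j *: 'D_1 (fun s => F s i l) t).
    by apply: is_deriveM; exact/derivableP.
  have := is_derive_sum h; congr is_derive.
  rewrite !mxE -big_split/=; apply: eq_bigr => l _.
  by rewrite !derive1E !derive_mx// !mxE addrC; congr +%R; rewrite mulrC.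
have d : derivable (fun s => F s *m G s) t 1.
  by apply/derivable_mxP => i j; have [] := H i j.
split=> //; rewrite derive1E derive_mx//.
by apply/matrixP => i j; rewrite mxE; have [_ <-] := H i j.
Qed.

End Matrix_integral.

(** * Linear equations on a short interval and Duhamel's formula *)

Section Linear_equation.
Context {R : realType}.
Implicit Types a b c t : R.

Lemma within_continuous_norm a b p q (u : R -> 'M[R]_(p, q)) :
  {within `[a, b], continuous u} -> {within `[a, b], continuous (fun t => `|u t|)}.
Proof.
by move=> cu x; apply: (continuous_comp (cu x)); exact: norm_continuous.
Qed.

Lemma norm_attains_max a b p q (u : R -> 'M[R]_(p, q)) :
  a <= b -> {within `[a, b], continuous u} ->
  exists2 c, a <= c <= b & forall t, a <= t <= b -> `|u t| <= `|u c|.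
Proof.
move=> ab /within_continuous_norm/(EVT_max ab)[c]; rewrite in_itv/= => cab h.
by exists c => // t tab; apply: h; rewrite in_itv.
Qed.

Lemma derivable_cstDmxint a b p q (F : R -> 'M[R]_(p, q)) C t :
  {within `[a, b], continuous F} -> a < t < b ->
  derivable (fun t => C + mxint a t F) t 1 /\ derive1 (fun t => C + mxint a t F) t = F t.
Proof.
move=> cF tab; have [d <-] := mxint_derivative cF tab.
have dC : derivable (fun=> C : 'M[R]_(p, q)) t 1 by exact: derivable_cst.
split; first exact: derivableD.
by rewrite !derive1E (deriveD dC d) derive_cst add0r.
Qed.

Context {n : nat}.
Implicit Types A X : R -> 'M[R]_n.

Lemma within_continuous_ode_rhs a b p A (u g : R -> 'M[R]_(n, p)) :
  {within `[a, b], continuous A} -> {within `[a, b], continuous u} ->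
  {within `[a, b], continuous g} ->
  {within `[a, b], continuous (fun t => A t *m u t + g t)}.
Proof.
by move=> cA cu cg; apply: within_continuous_mxD => //; exact: within_continuous_mulmx.
Qed.

(* Fixed-point form of the bound: at a point where [`|u|] is maximal, the integral
   equation gives [max <= max / 2 + c (b - a)]. *)
Lemma short_interval_bound a b p A (u g : R -> 'M[R]_(n, p)) (M c : R) :
  0 <= M -> 0 <= c -> a <= b -> n%:R * M * (b - a) <= 1 / 2 ->
  {within `[a, b], continuous A} -> {within `[a, b], continuous u} ->
  {within `[a, b], continuous g} ->
  (forall t, a <= t <= b -> `|A t| <= M) ->
  (forall t, a <= t <= b -> `|g t| <= c) ->
  (forall t, a <= t <= b -> u t = mxint a t (fun s => A s *m u s + g s)) ->
  forall t, a <= t <= b -> `|u t| <= 2 * c * (b - a).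
Proof.
move=> M0 c0 ab small cA cu cg AM gc eu.
have [t0 /andP[at0 t0b] umax] := norm_attains_max ab cu.
set S := `|u t0| in umax; have S0 : 0 <= S by exact: normr_ge0.
suff : S <= 2 * c * (b - a) by move=> h t /umax /le_trans; apply.
have : S <= (n%:R * M * S + c) * (t0 - a).
  rewrite {1}/S eu ?at0//; apply: mxint_norm_le => //.
  - by rewrite addr_ge0// !mulr_ge0.
  - apply: within_continuousW (lexx a) t0b _; exact: within_continuous_ode_rhs.
  move=> t /andP[ta tt0]; have tb := le_trans tt0 t0b.
  rewrite (le_trans (ler_normD _ _))// lerD//; last by rewrite gc ?ta.
  rewrite (le_trans (mx_norm_mul _ _))// -!mulrA ler_wpM2l//.
  by apply: ler_pM; rewrite ?normr_ge0//; [apply: AM|apply: umax]; rewrite ta.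
move=> h.
have h2 : S <= (n%:R * M * S + c) * (b - a).
  by apply: le_trans h _; rewrite ler_wpM2l ?lerB// addr_ge0// !mulr_ge0.
have h3 : n%:R * M * (b - a) * S <= 1 / 2 * S by rewrite ler_wpM2r.
lra.
Qed.

(** A left kernel vector satisfies [v = - v E], so its norm is at most [n |E| |v|], which is less
    than [|v|] unless [v = 0]. Serves both for fundamental matrices and for [I - G]. *)
Lemma small_perturbation_unit (E : 'M[R]_n) : n%:R * `|E| < 1 -> 1%:M + E \in unitmx.
Proof.
move=> small; rewrite unitmxE unitfE; apply/negP => /det0P[v v0].
rewrite mulmxDr mulmx1 => /eqP; rewrite addr_eq0 => /eqP vE.
have : `|v| <= n%:R * `|v| * `|E| by rewrite {1}vE normrN mx_norm_mul.
have v_gt0 : 0 < `|v| by rewrite normr_gt0.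
by rewrite mulrAC leNgt gtr_pMl// small.
Qed.

(** Variation of constants: since [X' = A X], the product rule gives [S' = A S + F] inside the
    interval, with [S a = 0]. Integrating back yields an equation valid up to the end points. *)
Lemma duhamel a b p A X (F : R -> 'M[R]_(n, p)) :
  a <= b -> {within `[a, b], continuous A} -> {within `[a, b], continuous F} ->
  is_fundamental A a b X ->
  let S t := X t *m mxint a t (fun s => invmx (X s) *m F s) in
  {within `[a, b], continuous S} /\
  forall t, a <= t <= b -> S t = mxint a t (fun s => A s *m S s + F s).
Proof.
move=> ab cA cF [cX dX uX] S.
have cY : {within `[a, b], continuous (fun s => invmx (X s) *m F s)}.
  by apply: within_continuous_mulmx => //; exact: within_continuous_invmx.
have cS : {within `[a, b], continuous S}.
  exact: within_continuous_mulmx cX (mxint_continuous ab cY).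
split=> //.
have dS t : a < t < b -> derivable S t 1 /\ derive1 S t = A t *m S t + F t.
  move=> tab; have [dXt eX] := dX t tab; have [dYt eY] := mxint_derivative cY tab.
  have [dSt eS] := derivative_mulmx dXt dYt.
  split; first exact: dSt.
  rewrite [LHS]eS eX eY !mulmxA mulmxV ?mul1mx//.
  by move: tab => /andP[/ltW ? /ltW ?]; apply: uX; apply/andP.
have Sa : S a = 0 by rewrite /S mxint_point mulmx0.
move=> t tab.
by have := mxint_FTC2 cS (within_continuous_ode_rhs cA cS cF) dS tab; rewrite Sa add0r.
Qed.

End Linear_equation.

(** * Fundamental matrices on a short interval by Picard iteration *)

Section Picard.
Context {R : realType}.

(** The intervals of radius [e k] about [u k] meet pairwise, and the supremum of their left ends
    lies in all of them. The explicit error makes the convergence of the Picard iterates uniform,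
    since their [e] does not depend on the point. *)
Lemma real_limit_of_nested (u e : nat -> R) :
  (forall k l, u k - e k <= u l + e l) -> exists L, forall k, `|u k - L| <= e k.
Proof.
move=> h; exists (sup (range (fun k => u k - e k))) => k.
have hs : has_sup (range (fun k => u k - e k)).
  by split; [exists (u 0%N - e 0%N), 0%N | exists (u 0%N + e 0%N) => _ [l _ <-]].
rewrite ler_distlC; apply/andP; split.
  by apply: (sup_upper_bound hs); exists k.
by apply: (ge_sup hs.1) => _ [l _ <-].
Qed.

Lemma uniform_limit_within_continuous (a b : R) p q (u : nat -> R -> 'M[R]_(p, q))
    (v : R -> 'M[R]_(p, q)) (e : nat -> R) :
  e @ \oo --> 0 -> (forall k, {within `[a, b], continuous (u k)}) ->
  (forall k t, a <= t <= b -> `|u k t - v t| <= e k) ->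
  {within `[a, b], continuous v}.
Proof.
move=> e0 cu uv; apply/subspace_continuousP => x xab.
apply/cvgrPdist_le => /= eps eps0.
have eps3 : 0 < eps / 3 by rewrite divr_gt0.
have [k ek] : exists k, e k <= eps / 3.
  have /cvgrPdist_le/(_ _ eps3)[k _ /(_ k (leqnn k))] := e0.
  by rewrite /= sub0r normrN => /(le_trans (ler_norm _)) h; exists k.
move/subspace_continuousP: (cu k) => /(_ x xab)/cvgrPdist_le/(_ _ eps3) cux.
near=> y.
have yab : `[a, b]%classic y by near: y; exact: withinT.
have hy : `|u k x - u k y| <= eps / 3 by near: y.
move: xab yab; rewrite /= !in_itv/= => /(uv k) hx /(uv k) hy'.
rewrite (_ : v x - v y = - (u k x - v x) + (u k x - u k y) + (u k y - v y)); last first.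
  by rewrite opprB !addrA subrK subrK.
rewrite (le_trans (ler_normD _ _))// (_ : eps = eps / 3 + eps / 3 + eps / 3); last by field.
rewrite lerD ?(le_trans hy')// (le_trans (ler_normD _ _))// lerD// normrN.
exact: le_trans hx _.
Unshelve. all: by end_near. Qed.

Context {n : nat}.

Fixpoint picard (a : R) (A : R -> 'M[R]_n) k (t : R) : 'M[R]_n :=
  if k is k'.+1 then 1%:M + mxint a t (fun s => A s *m picard a A k' s) else 1%:M.

(** Iteration contracts by 1/2 as soon as [n M (b - a) <= 1/2]. The stricter 1/4 gives
    [n |X - I| <= 1/2], so that [X t] is invertible as a perturbation of the identity. *)
Lemma short_interval_fundamental (a b M : R) (A : R -> 'M[R]_n) :
  0 <= M -> a <= b -> n%:R * M * (b - a) <= 1 / 4 ->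
  {within `[a, b], continuous A} -> (forall t, a <= t <= b -> `|A t| <= M) ->
  exists X, is_fundamental A a b X.
Proof.
move=> M0 ab small cA AM.
have ba0 : 0 <= b - a by rewrite subr_ge0.
pose P := picard a A.
have cP k : {within `[a, b], continuous (P k)}.
  elim: k => [|k IH]; first exact: within_continuous_cst.
  apply: within_continuous_mxD; first exact: within_continuous_cst.
  by apply: mxint_continuous => //; exact: within_continuous_mulmx.
have cAu (u v : R -> 'M[R]_n) t : t <= b -> {within `[a, b], continuous u} ->
    {within `[a, b], continuous v} ->
    {within `[a, t], continuous (fun s => A s *m (u s - v s))}.
  move=> tb cu cv; apply: within_continuousW (lexx a) tb _.
  apply: within_continuous_mulmx => //; apply: within_continuous_mxD => //.
  exact: within_continuous_mxN.
have step (u v : R -> 'M[R]_n) (c : R) : 0 <= c -> {within `[a, b], continuous u} ->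
    {within `[a, b], continuous v} -> (forall t, a <= t <= b -> `|u t - v t| <= c) ->
    forall t, a <= t <= b ->
    `|mxint a t (fun s => A s *m u s) - mxint a t (fun s => A s *m v s)| <= c / 2.
  move=> c0 cu cv uv t /andP[at_ tb].
  have cAw (w : R -> 'M[R]_n) : {within `[a, b], continuous w} ->
      {within `[a, t], continuous (fun s => A s *m w s)}.
    by move=> cw; apply: within_continuousW (lexx a) tb _; exact: within_continuous_mulmx.
  rewrite -(mxintN (cAw _ cv)) -(mxintD (cAw _ cu) (within_continuous_mxN (cAw _ cv))).
  rewrite (@eq_mxint _ _ _ _ _ _ (fun s => A s *m (u s - v s))); last first.
    by move=> s _; rewrite mulmxBr.
  have := @mxint_norm_le _ a t _ _ (fun s => A s *m (u s - v s)) (n%:R * M * c) at_.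
  move=> /(_ _ (cAu u v t tb cu cv)) H; apply: le_trans (H _ _) _.
  - by rewrite !mulr_ge0.
  - move=> s /andP[as_ st]; have sb := le_trans st tb.
    rewrite (le_trans (mx_norm_mul _ _))// -!mulrA ler_wpM2l//.
    by apply: ler_pM; rewrite ?normr_ge0//; [apply: AM|apply: uv]; rewrite as_.
  have : n%:R * M * c * (t - a) <= n%:R * M * c * (b - a).
    by rewrite ler_wpM2l ?lerB// !mulr_ge0.
  have : n%:R * M * (b - a) * c <= 1 / 4 * c by rewrite ler_wpM2r.
  lra.
(* [K] dominates the first increment, and [e] is such that [e k - e k.+1 = e k / 2] dominates the
   k-th one; the increments then telescope. *)
pose K : R := n%:R * M * `|1%:M : 'M[R]_n| * (b - a) + 1.
have K0 : 0 <= K by rewrite addr_ge0// !mulr_ge0.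
pose e k : R := 2 * K / 2 ^+ k.
have e_ge0 k : 0 <= e k by rewrite !mulr_ge0// invr_ge0 exprn_ge0.
have eS k : e k.+1 = e k / 2 by rewrite /e exprS; field; rewrite expf_neq0.
have e_cvg : e @ \oo --> 0.
  have -> : e = geometric (2 * K) (1 / 2).
    by apply/funext => k; rewrite /e /geometric/= expr_div_n expr1n mul1r.
  by apply: cvg_geometric; rewrite ger0_norm; lra.
have diff k t : a <= t <= b -> `|P k.+1 t - P k t| <= e k / 2.
  move: t; elim: k => [|k IH] t tab.
    rewrite /P/= addrC addKr /e expr0 divr1.
    have [at_ tb] := andP tab.
    have -> : 2 * K / 2 = K by field.
    have cA1 : {within `[a, t], continuous (fun s => A s *m (1%:M : 'M[R]_n))}.
      apply: within_continuousW (lexx a) tb _; apply: within_continuous_mulmx => //.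
      exact: within_continuous_cst.
    apply: le_trans (@mxint_norm_le _ a t _ _ _ (n%:R * M * `|1%:M : 'M[R]_n|) at_ _ cA1 _) _.
    - by rewrite !mulr_ge0.
    - move=> s /andP[as_ st]; rewrite (le_trans (mx_norm_mul _ _))// ler_wpM2r//.
      by rewrite ler_wpM2l// AM// as_ (le_trans st tb).
    rewrite /K -[leLHS]addr0 lerD// ler_wpM2l ?lerB// !mulr_ge0//.
  rewrite /P/= -/P opprD addrACA subrr add0r eS.
  by apply: step => //; [rewrite divr_ge0|exact: (cP k.+1)].
have dist k l t : a <= t <= b -> `|P (k + l)%N t - P k t| <= e k - e (k + l)%N.
  move=> tab; elim: l => [|l IH]; first by rewrite addn0 !subrr normr0.
  rewrite addnS -(subrKA (P (k + l)%N t)) (le_trans (ler_normD _ _))// addrC.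
  rewrite eS (_ : e k - _ = e k - e (k + l)%N + e (k + l)%N / 2); last by field.
  by rewrite lerD// diff.
have nested i j t : a <= t <= b -> forall k l, P k t i j - e k <= P l t i j + e l.
  move=> tab k l.
  have H k' l' : `|P (k' + l')%N t i j - P k' t i j| <= e k'.
    have := mx_norm_entry (P (k' + l')%N t - P k' t) i j; rewrite !mxE => /le_trans; apply.
    by rewrite (le_trans (dist _ _ _ tab))// gerBl.
  have [kl|lk] := leqP k l.
    have := H k (l - k)%N; rewrite subnKC// ler_distl => /andP[h _].
    by rewrite (le_trans h)// lerDl.
  have := H l (k - l)%N; rewrite subnKC ?(ltnW lk)// ler_distl => /andP[_ h].
  by rewrite lerBlDr (le_trans h)// lerDl.
(* The choice made for [Z] needs a limit at every real [t], so the condition [a <= t <= b] sits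
   under the existential, with 0 as value elsewhere. *)
have lim i j t : exists L, a <= t <= b -> forall k, `|P k t i j - L| <= e k.
  have [tab|] := boolP (a <= t <= b); last by exists 0.
  by have [L HL] := real_limit_of_nested (nested i j t tab); exists L.
pose Z t : 'M[R]_n := \matrix_(i, j) sval (cid (lim i j t)).
have PZ k t : a <= t <= b -> `|P k t - Z t| <= e k.
  move=> tab; apply/mx_norm_leP => // i j; rewrite !mxE.
  by case: (cid _) => L /= /(_ tab).
have cZ := uniform_limit_within_continuous e_cvg cP PZ.
have cAZ : {within `[a, b], continuous (fun s => A s *m Z s)}.
  exact: within_continuous_mulmx cA cZ.
have eZ t : a <= t <= b -> Z t = 1%:M + mxint a t (fun s => A s *m Z s).
  move=> tab; apply/eqP; rewrite -subr_eq0 -normr_le0; apply/ler_addgt0Pl => eps eps0.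
  have [k ek] : exists k, e k <= eps / 2.
    have e20 : 0 < eps / 2 by rewrite divr_gt0.
    have /cvgrPdist_le/(_ _ e20)[k _ /(_ k (leqnn k))] := e_cvg.
    by rewrite /= sub0r normrN => /(le_trans (ler_norm _)) h; exists k.
  (* Both [Z] and its Picard image lie within [e k / 2] of [P k.+1]. *)
  rewrite addr0 -(subrKA (P k.+1 t)) (le_trans (ler_normD _ _))//.
  rewrite distrC {1}(_ : eps = eps / 2 + eps / 2); last by field.
  apply: lerD.
    by rewrite (le_trans (PZ k.+1 t tab))// eS; have := e_ge0 k; lra.
  rewrite /P/= -/P opprD addrACA subrr add0r.
  by rewrite (le_trans (step _ _ _ (e_ge0 k) (cP k) cZ (PZ k) t tab))//; have := e_ge0 k; lra.
pose X t : 'M[R]_n := 1%:M + mxint a t (fun s => A s *m Z s).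
have XZ t : a <= t <= b -> X t = Z t by move=> /eZ.
(* [Z] solves the integral equation only on [a, b]; [X] agrees with it there and is
   derivable on ]a, b[ by the fundamental theorem of calculus. *)
exists X; split.
- by apply: eq_within_continuous cZ => t /XZ.
- move=> t tab; have [d ->] := derivable_cstDmxint 1%:M cAZ tab.
  split; first exact: d.
  by rewrite XZ//; move: tab => /andP[/ltW-> /ltW->].
(* For [u = X - I] the integral equation reads [u = \int (A u + A)]. The short-interval bound with
   [g = A] gives [|u| <= 2 M (b - a)], and [n] times this is at most 1/2. *)
move=> t tab; apply: small_perturbation_unit.
have cE : {within `[a, b], continuous (fun t => mxint a t (fun s => A s *m Z s))}.
  exact: mxint_continuous.
have := @short_interval_bound _ n a b n A _ A M M M0 M0 ab _ cA cE cA AM AM _ t tab.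
have small2 : n%:R * M * (b - a) <= 1 / 2 by lra.
move=> /(_ small2) H; apply: le_lt_trans (_ : n%:R * (2 * M * (b - a)) < 1); last by lra.
rewrite ler_wpM2l//; apply: H => s /andP[as_ sb]; apply: eq_mxint => r /andP[ar rs].
have -> : Z r = 1%:M + mxint a r (fun s => A s *m Z s) by rewrite -eZ// ar (le_trans rs).
by rewrite mulmxDr mulmx1 addrC.
Qed.

End Picard.

(** * Partitions of small mesh through prescribed points *)

Section Fine_partition.
Context {R : realType}.

(** The nodes are the points [s l] together with a uniform grid of step [T / N <= delta], sorted
    without repetition. A gap longer than [delta] would contain a grid point strictly inside,
    although its ends are consecutive nodes. *)
Lemma fine_partition q (T delta : R) (s : 'I_q -> R) :
  0 < T -> 0 < delta -> (forall l, 0 <= s l <= T) ->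
  exists m t, is_partition T s m t /\ forall r, (r < m)%N -> t r.+1 - t r <= delta.
Proof.
move=> T0 d0 hs; pose N := (Num.truncn (T / delta)).+1.
have N0 : (0 : R) < N%:R by rewrite ltr0n.
have TN : T / N%:R <= delta.
  rewrite ler_pdivrMr// mulrC -ler_pdivrMr// ltW//.
  by have /andP[] := truncn_itv (ltW (divr_gt0 T0 d0)).
pose L := sort <=%O
  (undup ([seq s l | l <- enum 'I_q] ++ [seq T / N%:R * i%:R | i <- iota 0 N.+1])).
have memL x : (x \in L) =
    (x \in [seq s l | l <- enum 'I_q]) || (x \in [seq T / N%:R * i%:R | i <- iota 0 N.+1]).
  by rewrite mem_sort mem_undup mem_cat.
have gridL i : (i <= N)%N -> T / N%:R * i%:R \in L.
  move=> iN; rewrite memL; apply/orP; right; apply/mapP; exists i => //.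
  by rewrite mem_iota.
have sL l : s l \in L.
  by rewrite memL; apply/orP; left; apply/mapP; exists l => //; rewrite mem_enum.
have L0 : 0 \in L by have := gridL 0%N (leq0n _); rewrite mulr0.
have LT : T \in L by have := gridL N (leqnn _); rewrite divfK// gt_eqF.
have Lbound x : x \in L -> 0 <= x <= T.
  rewrite memL => /orP[/mapP[l _ ->//]|/mapP[i]]; rewrite mem_iota/= add0n ltnS => iN ->.
  rewrite !mulr_ge0 ?invr_ge0 ?(ltW T0)//= mulrAC ler_pdivrMr// ler_wpM2l ?(ltW T0)//.
  by rewrite ler_nat.
have sortedL : sorted <%O L by rewrite sort_lt_sorted undup_uniq.
pose t := nth T L.
have tmono i j : (i < size L)%N -> (j < size L)%N -> (t i < t j) = (i < j)%N.
  by move=> hi hj; rewrite (lt_sorted_ltn_nth T sortedL).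
have tidx x : x \in L -> exists2 i, (i < size L)%N & t i = x.
  by move=> xL; exists (index x L); rewrite ?index_mem// /t nth_index.
have tL i : (i < size L)%N -> t i \in L by exact: mem_nth.
have szL : (0 < size L)%N by case: (L) L0.
have leL i : (i < size L)%N -> (i <= (size L).-1)%N by move=> iL; rewrite -ltnS prednK.
exists (size L).-1, t; split; first split.
- have [i iL t0] := tidx _ L0; apply/eqP; rewrite eq_le (andP (Lbound _ (tL _ szL))).1 andbT.
  by rewrite -t0 leNgt tmono// ltn0.
- have [i iL tT] := tidx _ LT; have lastL : ((size L).-1 < size L)%N by rewrite ltn_predL.
  apply/eqP; rewrite eq_le (andP (Lbound _ (tL _ lastL))).2/=.
  by rewrite -tT leNgt tmono// -leqNgt leL.
- move=> r rL; have rL1 : (r.+1 < size L)%N by rewrite -ltn_predRL.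
  by rewrite tmono// ltnW.
- by move=> l; have [i iL ti] := tidx _ (sL l); exists i => //; exact: leL.
move=> r rL; have rL1 : (r.+1 < size L)%N by rewrite -ltn_predRL.
rewrite leNgt; apply/negP => gap.
have /andP[tr0 trT] := Lbound _ (tL _ (ltnW rL1)).
have /andP[_ tr1T] := Lbound _ (tL _ rL1).
pose g := T / N%:R; have g0 : 0 < g by rewrite divr_gt0.
(* [g * i] is the first grid point strictly beyond [t r]. *)
pose i := (Num.truncn (t r / g)).+1.
have /andP[ilo ihi] := truncn_itv (divr_ge0 tr0 (ltW g0)).
have h1 : t r < g * i%:R by rewrite mulrC -ltr_pdivrMr.
have h2 : g * i%:R < t r.+1.
  have : g * (Num.truncn (t r / g))%:R <= t r by rewrite mulrC -ler_pdivlMr.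
  by rewrite /i -natr1 mulrDr mulr1; move: TN gap; rewrite -/g; lra.
have iN : (i <= N)%N.
  have : g * i%:R < g * N%:R by rewrite (lt_le_trans h2)// divfK// gt_eqF.
  by rewrite ltr_pM2l// ltr_nat => /ltnW.
have [j jL tj] := tidx _ (gridL i iN).
move: h1 h2; rewrite /g -tj !tmono ?(ltnW rL1)// ltnS => rj jr.
by have := leq_trans rj jr; rewrite ltnn.
Qed.

End Fine_partition.

(** * Restriction to the subintervals, relabelling, and gluing *)

Section Partition.
Context {R : realType} {q m : nat} (T : R) (s : 'I_q -> R) (t : nat -> R).
Context (part : is_partition T s m t).

Lemma partition_le i j : (i <= j <= m)%N -> t i <= t j.
Proof.
case/andP=> ij; rewrite -(subnKC ij); elim: (j - i)%N => [|l IH]; first by rewrite addn0.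
rewrite addnS => lm; apply: le_trans (IH (ltnW lm)) _.
by have [_ _ /(_ _ lm)/ltW] := part.
Qed.

Lemma partition_lt i j : (i < j <= m)%N -> t i < t j.
Proof.
case/andP=> ij jm; have [_ _ /(_ _ (leq_trans ij jm)) h _] := part.
by apply: lt_le_trans h _; apply: partition_le; rewrite ij.
Qed.

Lemma partition_ge0 i : (i <= m)%N -> 0 <= t i.
Proof. by move=> im; have [<- _ _ _] := part; apply: partition_le. Qed.

Lemma partition_leT i : (i <= m)%N -> t i <= T.
Proof. by move=> im; have [_ <- _ _] := part; apply: partition_le; rewrite im/=. Qed.

Lemma partition_gt0 : 0 < T -> (0 < m)%N.
Proof.
by move=> T0; case: (posnP m) part => // -> [-> /esym TE]; rewrite TE ltxx in T0.
Qed.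

Lemma partition_cover : 0 < T -> forall x, 0 <= x <= T ->
  exists2 r, (r < m)%N & t r <= x <= t r.+1.
Proof.
move=> T0 x /andP[x0 xT].
have : forall N, (0 < N <= m)%N -> x <= t N -> exists2 r, (r < m)%N & t r <= x <= t r.+1.
  elim=> // N IH /= Nm xN.
  have [xt|tx] := leP (t N) x; first by exists N => //; rewrite xt.
  case: N tx IH Nm {xN} => [|N] tx IH Nm; last by apply: IH; [exact: ltnW|exact: ltW].
  by have [t0 _ _ _] := part; move: tx; rewrite t0 ltNge x0.
by have [_ tm _ _] := part; move=> /(_ m); rewrite partition_gt0// leqnn tm; exact.
Qed.

Lemma within_continuous_piece (U : topologicalType) (F : R -> U) r : (r < m)%N ->
  {within `[0, T], continuous F} -> {within `[t r, t r.+1], continuous F}.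
Proof.
by move=> rm; apply: within_continuousW; [exact: partition_ge0 (ltnW rm)|exact: partition_leT].
Qed.

Lemma mxint_partition p p' (F : R -> 'M[R]_(p, p')) :
  {within `[0, T], continuous F} ->
  mxint 0 T F = \sum_(r < m) mxint (t r) (t r.+1) F.
Proof.
move=> cF; have [t0 tm _ _] := part.
suff H N : (N <= m)%N -> mxint 0 (t N) F = \sum_(r < N) mxint (t r) (t r.+1) F.
  by rewrite -H// tm.
elim: N => [|N IH] Nm; first by rewrite big_ord0 t0 mxint_point.
rewrite big_ord_recr/= -IH ?(ltnW Nm)//; apply: mxint_cat.
  by rewrite partition_ge0 ?(ltnW Nm)// partition_le// leqnSn.
by apply: within_continuousW cF => //; exact: partition_leT.
Qed.

(** Strict monotonicity makes the index [i <= m] with [t i = s l] unique, so after exchanging the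
    sums each [B l] is counted exactly once. *)
Lemma Bpart_sum n (B : 'I_q -> 'M[R]_n) (x : R -> 'cV[R]_n) :
  \sum_(l < q) B l *m x (s l) = \sum_(i < m.+1) Bpart s B t i *m x (t i).
Proof.
under [RHS]eq_bigr do rewrite /Bpart mulmx_suml big_mkcond.
rewrite exchange_big/=; apply: eq_bigr => l _.
have [_ _ _ /(_ l)[i im ti]] := part.
have im' : (i < m.+1)%N by [].
rewrite (bigD1 (Ordinal im'))//= ti eqxx big1 ?addr0// => j /eqP ji.
case: eqP => // sj; case: ji; apply/val_inj => /=; apply/eqP.
have jm : (j <= m)%N by rewrite -ltnS.
rewrite eqn_leq; apply/andP; split; rewrite leqNgt; apply/negP => h.
  by have := @partition_lt i j; rewrite h jm ti sj ltxx => /(_ isT).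
by have := @partition_lt j i; rewrite h im ti sj ltxx => /(_ isT).
Qed.

(** Pieces are attached one at a time, by pasting along two closed intervals; agreement at the
    common node makes the choice of value there harmless. *)
Lemma glue p p' (y : nat -> R -> 'M[R]_(p, p')) :
  0 < T ->
  (forall r, (r < m)%N -> {within `[t r, t r.+1], continuous (y r)}) ->
  (forall r, (r.+1 < m)%N -> y r (t r.+1) = y r.+1 (t r.+1)) ->
  exists x, {within `[0, T], continuous x} /\
    forall r u, (r < m)%N -> t r <= u <= t r.+1 -> x u = y r u.
Proof.
move=> T0 cy yy; have m0 := partition_gt0 T0; have [t0 tm tlt _] := part.
suff H N : (N < m)%N -> exists x, {within `[0, t N.+1], continuous x} /\
    forall r u, (r <= N)%N -> t r <= u <= t r.+1 -> x u = y r u.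
  have [|x] := H m.-1; first by rewrite ltn_predL.
  rewrite prednK// tm => -[cx xy]; exists x; split=> // r u rm; apply: xy.
  by rewrite -ltnS prednK.
elim: N => [|N IH] Nm.
  exists (y 0%N); split; first by rewrite -t0; exact: cy.
  by move=> r u; rewrite leqn0 => /eqP->.
have [x [cx xy]] := IH (ltnW Nm).
pose x' u := if u <= t N.+1 then x u else y N.+1 u.
have x't u : t N.+1 <= u -> x' u = y N.+1 u.
  rewrite /x'; case: ltgtP => // <- _.
  by rewrite (xy N)// ?yy// lexx ltW// tlt// ltnW.
exists x'; split.
  have -> : `[0, t N.+2]%classic = `[0, t N.+1] `|` `[t N.+1, t N.+2].
    apply/seteqP; split=> u /=; rewrite !in_itv/=.
      by case: (leP u (t N.+1)) => h /andP[u0 uN]; [left; rewrite u0|right; rewrite ltW].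
    have h0 := partition_ge0 (ltnW Nm); have hN := ltW (tlt _ Nm).
    by case=> /andP[h1 h2]; rewrite ?h1 ?h2 ?(le_trans h2)// (le_trans h0).
  apply: withinU_continuous; [exact: itv_closed|exact: itv_closed|..].
  - by apply: eq_within_continuous cx => u /andP[_ h]; rewrite /x' h.
  - by apply: eq_within_continuous (cy _ Nm) => u /andP[h _]; rewrite x't.
move=> r u; rewrite leq_eqVlt => /predU1P[->|rN] /andP[h1 h2]; first exact: x't.
have uN : u <= t N.+1.
  by apply: le_trans h2 _; apply: partition_le; rewrite rN ltnW.
by rewrite /x' uN; apply: xy; rewrite ?h1.
Qed.

End Partition.

(** * The problem as an integral equation with moments *)

Section Integral_form.
Context {R : realType} {n k q : nat} (T : R).
Context (A : R -> 'M[R]_n) (phi psi : 'I_k -> R -> 'M[R]_n).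
Context (s : 'I_q -> R) (B : 'I_q -> 'M[R]_n).
Context (hA : {within `[0, T], continuous A}).
Context (hphi : forall j, {within `[0, T], continuous (phi j)}).
Context (hpsi : forall j, {within `[0, T], continuous (psi j)}).
Context (hs : forall l, 0 <= s l <= T).
Implicit Types (f x : R -> 'cV[R]_n) (c : 'I_k -> 'cV[R]_n).

(** The moments are a free parameter [c]: for fixed [c] the nonlocal equation becomes an ordinary
    linear one, and the requirement that [c] be the moments of the solution is imposed
    separately. *)
Definition source c f (u : R) : 'cV[R]_n := \sum_(j < k) phi j u *m c j + f u.

Definition moment x (j : 'I_k) : 'cV[R]_n := mxint 0 T (fun u => psi j u *m x u).

Lemma source_continuous c f :
  {within `[0, T], continuous f} -> {within `[0, T], continuous (source c f)}.
Proof.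
move=> cf; apply: within_continuous_mxD => //.
apply: (@within_continuous_sum _ 0 T _ _ (index_enum 'I_k)
  (fun j u => phi j u *m c j)) => j.
by apply: within_continuous_mulmx => //; exact: within_continuous_cst.
Qed.

Lemma moment_integrand_continuous x j : {within `[0, T], continuous x} ->
  {within `[0, T], continuous (fun u => psi j u *m x u)}.
Proof. by move=> cx; exact: within_continuous_mulmx (@hpsi j) cx. Qed.

(** The kernel is separable: [phi j u] leaves the integral, so [x] enters the nonlocal term only
    through its [k] moments. *)
Lemma kernel_source x f u : {within `[0, T], continuous x} ->
  \sum_(j < k) mxint 0 T (fun tau => phi j u *m psi j tau *m x tau) + f u =
  source (moment x) f u.
Proof.
move=> cx; congr (_ + _); apply: eq_bigr => j _.
rewrite /moment -mxintMl; last exact: moment_integrand_continuous.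
by apply: eq_mxint => v _; rewrite mulmxA.
Qed.

(** Unlike [is_solution], this form survives joining at the nodes, where nothing is known about
    derivatives. *)
Definition integral_equation f x := forall u, 0 <= u <= T ->
  x u = x 0 + mxint 0 u (fun v => A v *m x v + source (moment x) f v).

Lemma solution_integral_equation f d x : {within `[0, T], continuous f} ->
  is_solution T A phi psi s B f d x -> integral_equation f x.
Proof.
move=> cf [cx dx ex _]; apply: mxint_FTC2 => //.
  by apply: within_continuous_ode_rhs => //; exact: source_continuous.
move=> u uT; split; first exact: (dx u uT).1.
by rewrite ex// -addrA kernel_source.
Qed.

(** The solution produced is the right-hand side of the integral equation rather than [x]: as a
    primitive it is differentiable at once, and its agreement with [x] on [[0, T]] preserves the
    moments and the multipoint values. *)
Lemma integral_equation_solution f x :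
  {within `[0, T], continuous f} -> {within `[0, T], continuous x} ->
  integral_equation f x ->
  exists2 y, is_solution T A phi psi s B f (\sum_(l < q) B l *m x (s l)) y &
    forall u, 0 <= u <= T -> y u = x u.
Proof.
move=> cf cx ex.
pose g v := A v *m x v + source (moment x) f v.
have cg : {within `[0, T], continuous g}.
  by apply: within_continuous_ode_rhs => //; exact: source_continuous.
pose y u := x 0 + mxint 0 u g.
have yx u : 0 <= u <= T -> y u = x u by move=> /ex.
have cy : {within `[0, T], continuous y}.
  by apply: eq_within_continuous cx => u /yx.
have yxo u : 0 < u < T -> y u = x u by move=> /andP[/ltW u0 /ltW uT]; rewrite yx// u0.
have dy u : 0 < u < T -> derivable y u 1 /\ derive1 y u = g u.
  exact: (derivable_cstDmxint (x 0) cg).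
have myx : moment y = moment x.
  by apply/funext => j; apply: eq_mxint => v vT; rewrite yx.
exists y; last exact: yx.
split; first exact: cy.
- move=> u uT; split; first exact: (dy u uT).1.
  rewrite /prop_for /continuous_at (dy u uT).2.
  have := within_continuous_interior cg uT; apply: cvg_trans.
  apply: near_eq_cvg; near=> v; apply/esym; apply: (dy v _).2.
  have : v \in `]0, T[ by near: v; apply: near_in_itvoo; rewrite in_itv.
  by rewrite in_itv.
- move=> u uT; transitivity (g u); first exact: (dy u uT).2.
  by rewrite -addrA (kernel_source f u cy) myx yxo.
- by apply: eq_bigr => l _; rewrite yx.
Unshelve. all: by end_near. Qed.

End Integral_form.

(** * Solutions on one subinterval, and their assembly *)

Section Pieces.
Context {R : realType} {n k q m : nat} (T : R).
Context (A : R -> 'M[R]_n) (phi psi : 'I_k -> R -> 'M[R]_n).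
Context (s : 'I_q -> R) (t : nat -> R) (X : nat -> R -> 'M[R]_n).
Context (hT : 0 < T).
Context (hA : {within `[0, T], continuous A}).
Context (hphi : forall j, {within `[0, T], continuous (phi j)}).
Context (hpsi : forall j, {within `[0, T], continuous (psi j)}).
Context (part : is_partition T s m t).
Context (hX : forall r, (r < m)%N -> is_fundamental A (t r) (t r.+1) (X r)).
Implicit Types (f x : R -> 'cV[R]_n) (c : 'I_k -> 'cV[R]_n) (lam : nat -> 'cV[R]_n).

(** The expression of [XintX], for [F] of any width [p], so that the matrices [A], [phi j] and the
    column [f] are treated alike; for [p = n] the two are convertible. *)
Definition duhamel_term p r (F : R -> 'M[R]_(n, p)) (u : R) :=
  X r u *m mxint (t r) u (fun v => invmx (X r v) *m F v).

Lemma duhamel_termE p r (F : R -> 'M[R]_(n, p)) :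
  (r < m)%N -> {within `[0, T], continuous F} ->
  {within `[t r, t r.+1], continuous (duhamel_term r F)} /\
  forall u, t r <= u <= t r.+1 ->
    duhamel_term r F u = mxint (t r) u (fun v => A v *m duhamel_term r F v + F v).
Proof.
move=> rm cF; apply: duhamel.
- by apply: (partition_le part); rewrite leqnSn.
- exact: within_continuous_piece part _ _ _ rm hA.
- exact: within_continuous_piece part _ _ _ rm cF.
- exact: hX.
Qed.

Lemma duhamel_term_start p r (F : R -> 'M[R]_(n, p)) : duhamel_term r F (t r) = 0.
Proof. by rewrite /duhamel_term mxint_point mulmx0. Qed.

Lemma invX_continuous p r (F : R -> 'M[R]_(n, p)) u :
  (r < m)%N -> t r <= u <= t r.+1 -> {within `[0, T], continuous F} ->
  {within `[t r, u], continuous (fun v => invmx (X r v) *m F v)}.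
Proof.
move=> rm /andP[_ uR] cF; apply: within_continuousW (lexx _) uR _.
have [cX _ uX] := hX rm.
apply: within_continuous_mulmx; first exact: within_continuous_invmx.
exact: within_continuous_piece part _ _ _ rm cF.
Qed.

Lemma duhamel_termD p r (F G : R -> 'M[R]_(n, p)) u :
  (r < m)%N -> t r <= u <= t r.+1 ->
  {within `[0, T], continuous F} -> {within `[0, T], continuous G} ->
  duhamel_term r (fun v => F v + G v) u = duhamel_term r F u + duhamel_term r G u.
Proof.
move=> rm ru cF cG; rewrite /duhamel_term -mulmxDr -mxintD; try exact: invX_continuous.
by congr (_ *m _); apply: eq_mxint => v _; rewrite mulmxDr.
Qed.

Lemma duhamel_term_sum p r (I : Type) (l : seq I) (F : I -> R -> 'M[R]_(n, p)) u :
  (r < m)%N -> t r <= u <= t r.+1 ->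
  (forall i, {within `[0, T], continuous (F i)}) ->
  duhamel_term r (fun v => \sum_(i <- l) F i v) u = \sum_(i <- l) duhamel_term r (F i) u.
Proof.
move=> rm ru cF; rewrite /duhamel_term -mulmx_sumr -mxint_sum.
  by congr (_ *m _); apply: eq_mxint => v _; rewrite mulmx_sumr.
by move=> i; exact: invX_continuous.
Qed.

Lemma duhamel_termM p p' r (F : R -> 'M[R]_(n, p)) (C : 'M[R]_(p, p')) u :
  (r < m)%N -> t r <= u <= t r.+1 -> {within `[0, T], continuous F} ->
  duhamel_term r (fun v => F v *m C) u = duhamel_term r F u *m C.
Proof.
move=> rm ru cF; rewrite /duhamel_term -mulmxA -mxintMr; last exact: invX_continuous.
by congr (_ *m _); apply: eq_mxint => v _; rewrite mulmxA.
Qed.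

(** Subtracting the initial value [l] leaves an unknown that starts at 0 with forcing
    [A l + source]. Hence [A] under the integrals of [Vmx] and [Dmx], and no normalization of
    [X r (t r)]. *)
Definition piece r (l : 'cV[R]_n) c f (u : R) : 'cV[R]_n :=
  l + duhamel_term r (fun v => A v *m l + source phi c f v) u.

Lemma piece_source_continuous (l : 'cV[R]_n) c f : {within `[0, T], continuous f} ->
  {within `[0, T], continuous (fun v => A v *m l + source phi c f v)}.
Proof.
move=> cf; apply: within_continuous_ode_rhs => //.
  exact: within_continuous_cst.
exact: source_continuous.
Qed.

Lemma piece_continuous r l c f : (r < m)%N -> {within `[0, T], continuous f} ->
  {within `[t r, t r.+1], continuous (piece r l c f)}.
Proof.
move=> rm cf; have [cS _] := duhamel_termE rm (@piece_source_continuous l c f cf).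
exact: within_continuous_mxD (@within_continuous_cst _ _ _ _ l) cS.
Qed.

Lemma piece_start r l c f : piece r l c f (t r) = l.
Proof. by rewrite /piece duhamel_term_start addr0. Qed.

Lemma piece_equation r l c f u : (r < m)%N -> {within `[0, T], continuous f} ->
  t r <= u <= t r.+1 ->
  piece r l c f u = l + mxint (t r) u (fun v => A v *m piece r l c f v + source phi c f v).
Proof.
move=> rm cf ru; have [_ e] := duhamel_termE rm (@piece_source_continuous l c f cf).
rewrite {1}/piece (e u ru).
by congr (_ + _); apply: eq_mxint => v _; rewrite addrA /piece mulmxDr [A v *m l + _]addrC.
Qed.

Lemma ode_rhs_continuous c f x : {within `[0, T], continuous f} ->
  {within `[0, T], continuous x} ->
  {within `[0, T], continuous (fun v => A v *m x v + source phi c f v)}.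
Proof.
move=> cf cx.
exact: within_continuous_ode_rhs hA cx (@source_continuous _ _ _ T phi hphi c f cf).
Qed.

(** The hypothesis on [c] says that it is the family of moments of the glued function, so
    [source phi c f] becomes the source of that function itself. The equation on [[0, T]] follows by
    adding those of the pieces. *)
Lemma glued_solution lam c f : {within `[0, T], continuous f} ->
  (forall r, (r.+1 < m)%N -> piece r (lam r) c f (t r.+1) = lam r.+1) ->
  (forall j, c j =
     \sum_(r < m) mxint (t r) (t r.+1) (fun u => psi j u *m piece r (lam r) c f u)) ->
  exists x, [/\ {within `[0, T], continuous x}, integral_equation T A phi psi f x &
    forall r u, (r < m)%N -> t r <= u <= t r.+1 -> x u = piece r (lam r) c f u].
Proof.
move=> cf match_ ec.
have [||x [cx xp]] := @glue _ _ _ T s t part n 1 (fun r => piece r (lam r) c f) hT.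
- by move=> r rm; exact: piece_continuous.
- by move=> r rm; rewrite piece_start match_.
have mom : moment T psi x = c.
  apply/funext => j; rewrite ec /moment (mxint_partition part); last first.
    exact: moment_integrand_continuous.
  by apply: eq_bigr => r _; apply: eq_mxint => u ru; rewrite (xp r).
exists x; split; [exact: cx| |exact: xp]; rewrite /integral_equation mom.
pose g v : 'cV[R]_n := A v *m x v + source phi c f v.
have cg : {within `[0, T], continuous g} by exact: (@ode_rhs_continuous c f x cf cx).
have [t0 tm _ _] := part.
have rr r : (r < m)%N -> t r <= t r.+1.
  by move=> rm; apply: (partition_le part); rewrite leqnSn.
have piece_g r u : (r < m)%N -> t r <= u <= t r.+1 -> x u = x (t r) + mxint (t r) u g.
  move=> rm ru; have xr : x (t r) = lam r.
    by rewrite (xp r (t r) rm) ?piece_start// lexx rr.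
  have [ru1 ru2] := andP ru.
  transitivity (piece r (lam r) c f u); first exact: xp.
  rewrite (@piece_equation r (lam r) c f u rm cf ru) xr; congr (_ + _).
  apply: eq_mxint => v /andP[v1 v2]; congr (_ *m _ + _).
  by apply/esym/xp => //; rewrite v1 (le_trans v2).
have cat r u : (r < m)%N -> t r <= u <= t r.+1 ->
    mxint 0 (t r) g + mxint (t r) u g = mxint 0 u g.
  move=> rm /andP[ru1 ru2]; apply/esym/mxint_cat.
    by rewrite (partition_ge0 part (ltnW rm)).
  apply: within_continuousW (lexx 0) _ cg.
  exact: le_trans ru2 (partition_leT part rm).
have nodes r : (r < m)%N -> x (t r) = x 0 + mxint 0 (t r) g.
  elim: r => [|r IH] rm; first by rewrite t0 mxint_point addr0.
  have ru : t r <= t r.+1 <= t r.+1 by rewrite rr ?lexx// ltnW.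
  by rewrite (piece_g r _ (ltnW rm) ru) (IH (ltnW rm)) -addrA (cat r _ (ltnW rm) ru).
move=> u uT; have [r rm ru] := partition_cover part hT uT.
by rewrite (piece_g r u rm ru) (nodes r rm) -addrA (cat r u rm ru).
Qed.

(** The difference [w] of the two sides solves [w = \int A w], and the short-interval bound with
    [c = 0] forces it to vanish. *)
Lemma solution_piece (M : R) f x r : 0 <= M -> {within `[0, T], continuous f} ->
  {within `[0, T], continuous x} -> integral_equation T A phi psi f x -> (r < m)%N ->
  (forall u : R, 0 <= u <= T -> `|A u| <= M) -> n%:R * M * (t r.+1 - t r) <= 1 / 2 ->
  forall u, t r <= u <= t r.+1 -> x u = piece r (x (t r)) (moment T psi x) f u.
Proof.
move=> M0 cf cx ex rm AM small.
set c := moment T psi x; set P := piece r (x (t r)) c f.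
have rr : t r <= t r.+1 by apply: (partition_le part); rewrite leqnSn.
have t0 := partition_ge0 part (ltnW rm); have tT := partition_leT part rm.
have cP : {within `[t r, t r.+1], continuous P} by exact: piece_continuous.
have cx' := within_continuous_piece part rm cx.
have cA' := within_continuous_piece part rm hA.
have cS' := within_continuous_piece part rm (@source_continuous _ _ _ T phi hphi c f cf).
pose w u : 'cV[R]_n := x u - P u.
have cw : {within `[t r, t r.+1], continuous w}.
  exact: within_continuous_mxD cx' (within_continuous_mxN cP).
pose g v : 'cV[R]_n := A v *m x v + source phi c f v.
have cg : {within `[0, T], continuous g} by exact: (@ode_rhs_continuous c f x cf cx).
have cg' := within_continuous_piece part rm cg.
pose gP v : 'cV[R]_n := A v *m P v + source phi c f v.
have cgP : {within `[t r, t r.+1], continuous gP}.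
  exact: within_continuous_ode_rhs cA' cP cS'.
have xg u : t r <= u <= t r.+1 -> x u = x (t r) + mxint (t r) u g.
  move=> /andP[ru1 ru2]; have uT := le_trans ru2 tT.
  have u0T : 0 <= u <= T by rewrite (le_trans t0).
  have tr0T : 0 <= t r <= T by rewrite t0 (le_trans ru1).
  rewrite [LHS](ex u u0T) [in RHS](ex (t r) tr0T) -/c -/g -addrA; congr (_ + _).
  apply: mxint_cat; first by rewrite t0.
  exact: within_continuousW (lexx 0) uT cg.
have ew u : t r <= u <= t r.+1 -> w u = mxint (t r) u (fun v => A v *m w v + 0).
  move=> ru; have [ru1 ru2] := andP ru.
  rewrite /w [x u](xg u ru) [P u](@piece_equation r (x (t r)) c f u rm cf ru) -/P -/gP.
  have sub := within_continuousW (lexx (t r)) ru2.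
  rewrite opprD addrACA subrr add0r -(mxintN (sub _ _ cgP)).
  rewrite -(mxintD (sub _ _ cg') (within_continuous_mxN (sub _ _ cgP))).
  by apply: eq_mxint => v _; rewrite /g /gP opprD addrACA subrr mulmxBr.
move=> u ru; apply/eqP; rewrite -subr_eq0 -normr_le0.
have := @short_interval_bound _ n (t r) (t r.+1) 1 A w (fun=> 0) M 0 M0 (lexx 0) rr small
  cA' cw (@within_continuous_cst _ _ _ 'cV[R]_n 0).
rewrite mulr0 mul0r; apply => //.
  by move=> v /andP[v1 v2]; apply: AM; rewrite (le_trans t0)// (le_trans v2).
by move=> v _; rewrite normr0.
Qed.

(** Linearity separates the contributions of the initial value, of the moments and of [f]; the
    coefficients in [Gmx], [Vmx] and [Dmx] are read off from this expansion. *)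
Lemma pieceE r l c f u : (r < m)%N -> t r <= u <= t r.+1 ->
  {within `[0, T], continuous f} ->
  piece r l c f u = l + XintX t X r A u *m l
    + \sum_(j < k) XintX t X r (phi j) u *m c j + duhamel_term r f u.
Proof.
move=> rm ru cf; rewrite /piece -!addrA; congr (_ + _).
have cphic j : {within `[0, T], continuous (fun v => phi j v *m c j)}.
  exact: within_continuous_mulmx (@hphi j) (@within_continuous_cst _ _ _ _ (c j)).
have cAl : {within `[0, T], continuous (fun v => A v *m l)}.
  exact: within_continuous_mulmx hA (@within_continuous_cst _ _ _ _ l).
have csum : {within `[0, T], continuous (fun v => \sum_(j < k) phi j v *m c j)}.
  exact: within_continuous_sum cphic.
rewrite (duhamel_termD rm ru cAl (@source_continuous _ _ _ T phi hphi c f cf)).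
rewrite (duhamel_termM _ rm ru hA); congr (_ + _).
rewrite /source (duhamel_termD rm ru csum cf) (duhamel_term_sum _ rm ru cphic).
congr (_ + _); apply: eq_bigr => j _; exact: duhamel_termM rm ru (@hphi j).
Qed.

End Pieces.

(** * Linear algebra of block systems *)

Section Block_systems.
Context {R : realType}.

Lemma mxcol_eqP (p n p' : nat) (c d : 'I_p -> 'M[R]_(n, p')) :
  \mxcol_j c j = \mxcol_j d j <-> forall j, c j = d j.
Proof.
split=> [e j|e]; last exact: eq_mxcol.
by have /mxcolP/(_ j) := e; rewrite !mxcolK.
Qed.

(** [det0P] provides a left kernel vector, hence the transposes. *)
Lemma unitmx_inj (p : nat) (Q : 'M[R]_p) :
  (forall v : 'cV[R]_p, Q *m v = 0 -> v = 0) -> Q \in unitmx.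
Proof.
move=> h; rewrite -unitmx_tr unitmxE unitfE; apply/negP => /det0P[v v0 vQ].
have := h v^T; rewrite -{1}[Q]trmxK -trmx_mul vQ trmx0 => /(_ erefl) vT0.
by move: v0; rewrite -[v]trmxK vT0 trmx0 eqxx.
Qed.

(** Moving [u] to the left gives [(I - G)(C - u) = w + G u]. In the application [u] consists of the
    moments of the piecewise constant function with values [lam], and [w + G u] produces [Vmx]. *)
Lemma fixpoint_unitmx (p : nat) (G : 'M[R]_p) (C u w : 'cV[R]_p) :
  1%:M - G \in unitmx ->
  C = u + w + G *m C <-> C = u + invmx (1%:M - G) *m (w + G *m u).
Proof.
move=> uG; set N := 1%:M - G.
have NE v : N *m v = v - G *m v by rewrite mulmxBl mul1mx.
split=> e.
  have Cu : C - u = w + G *m C by apply/eqP; rewrite subr_eq {1}e -addrA addrC.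
  have : N *m (C - u) = w + G *m u.
    by rewrite NE mulmxBr Cu opprB -addrA; congr (_ + _); rewrite addrC subrK.
  by move=> <-; rewrite mulKmx// addrC subrK.
have : N *m (C - u) = w + G *m u by rewrite e addrC addKr mulKVmx.
rewrite NE mulmxBr => /eqP; rewrite subr_eq => /eqP Cu.
rewrite -[LHS](subrK u) Cu -(addrA w) [G *m u + _]addrC subrK.
by rewrite -(addrA u) [RHS]addrC.
Qed.

(** Node values are indexed by [nat], like [t] and [X]; 0 is the default beyond the last block. *)
Definition nat_blocks (m n : nat) (v : 'cV[R]_(\sum_(i < m) n)) (i : nat) : 'cV[R]_n :=
  if insub i is Some j then submxcol (p_ := fun=> n) v j else 0.

Lemma nat_blocksK (m n : nat) (v : 'cV[R]_(\sum_(i < m) n)) :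
  \mxcol_(i < m) nat_blocks v i = v.
Proof. by rewrite -[RHS]submxcolK; apply: eq_mxcol => i; rewrite /nat_blocks valK. Qed.

End Block_systems.

(** * Elimination of the moments *)

Section Parametrized_system.
Context {R : realType} {n k q m : nat} (T : R).
Context (A : R -> 'M[R]_n) (phi psi : 'I_k -> R -> 'M[R]_n).
Context (s : 'I_q -> R) (B : 'I_q -> 'M[R]_n).
Context (t : nat -> R) (X : nat -> R -> 'M[R]_n).
Context (hT : 0 < T).
Context (hA : {within `[0, T], continuous A}).
Context (hphi : forall j, {within `[0, T], continuous (phi j)}).
Context (hpsi : forall j, {within `[0, T], continuous (psi j)}).
Context (part : is_partition T s m t).
Context (hX : forall r, (r < m)%N -> is_fundamental A (t r) (t r.+1) (X r)).
Implicit Types (f : R -> 'cV[R]_n) (c : 'I_k -> 'cV[R]_n) (lam : nat -> 'cV[R]_n).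

Definition Psi (j : 'I_k) (i : nat) := mxint (t i) (t i.+1) (psi j).

Definition Wmx (p : 'I_k) (r : nat) :=
  mxint (t r) (t r.+1) (fun u => psi p u *m XintX t X r A u).

Definition source_moment f (p : 'I_k) : 'cV[R]_n :=
  \sum_(r < m) mxint (t r) (t r.+1) (fun u => psi p u *m duhamel_term t X r f u).

Lemma psi_duhamel_continuous p' (p : 'I_k) r (F : R -> 'M[R]_(n, p')) :
  (r < m)%N -> {within `[0, T], continuous F} ->
  {within `[t r, t r.+1], continuous (fun u => psi p u *m duhamel_term t X r F u)}.
Proof.
move=> rm cF.
have [cS _] := duhamel_termE hA part hX rm cF.
exact: within_continuous_mulmx (within_continuous_piece part rm (@hpsi p)) cS.
Qed.

Lemma moment_piece (p : 'I_k) r (l : 'cV[R]_n) c f : (r < m)%N ->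
  {within `[0, T], continuous f} ->
  mxint (t r) (t r.+1) (fun u => psi p u *m piece A phi t X r l c f u) =
  (Psi p r + Wmx p r) *m l
  + \sum_(j < k) mxint (t r) (t r.+1) (fun u => psi p u *m XintX t X r (phi j) u) *m c j
  + mxint (t r) (t r.+1) (fun u => psi p u *m duhamel_term t X r f u).
Proof.
move=> rm cf.
have cpsi := within_continuous_piece part rm (@hpsi p).
have cpsil : {within `[t r, t r.+1], continuous (fun u => psi p u *m l)}.
  exact: within_continuous_mulmx cpsi (@within_continuous_cst _ _ _ _ l).
have cWF (F : R -> 'M[R]_n) (v : 'cV[R]_n) : {within `[0, T], continuous F} ->
    {within `[t r, t r.+1], continuous (fun u => psi p u *m XintX t X r F u *m v)}.
  move=> cF.
  have h1 : {within `[t r, t r.+1], continuous (fun u => psi p u *m XintX t X r F u)}.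
    exact (@psi_duhamel_continuous _ p r F rm cF).
  have h2 : {within `[t r, t r.+1], continuous (fun=> v)}.
    exact: within_continuous_cst.
  exact (within_continuous_mulmx h1 h2).
have csum : {within `[t r, t r.+1], continuous
    (fun u => \sum_(j < k) psi p u *m XintX t X r (phi j) u *m c j)}.
  by apply: within_continuous_sum => j; exact: (cWF (phi j) (c j) (@hphi j)).
have cf' := @psi_duhamel_continuous _ p r f rm cf.
transitivity (mxint (t r) (t r.+1) (fun u =>
    psi p u *m l + psi p u *m XintX t X r A u *m l
    + \sum_(j < k) psi p u *m XintX t X r (phi j) u *m c j
    + psi p u *m duhamel_term t X r f u)).
  apply: eq_mxint => u ru; rewrite (pieceE hA hphi part hX l c rm ru cf) !mulmxDr mulmxA.
  by congr (_ + _ + _); rewrite mulmx_sumr; apply: eq_bigr => j _; rewrite mulmxA.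
have c2 := within_continuous_mxD cpsil (cWF A l hA).
rewrite (mxintD (within_continuous_mxD c2 csum) cf') (mxintD c2 csum).
rewrite (mxintD cpsil (cWF A l hA)) (mxintMr _ cpsi).
rewrite (mxintMr _ (@psi_duhamel_continuous _ p r A rm hA)) -mulmxDl.
congr (_ + _ + _).
rewrite (mxint_sum _ (fun j => cWF (phi j) (c j) (@hphi j))); apply: eq_bigr => j _.
exact: mxintMr (@psi_duhamel_continuous _ p r (phi j) rm (@hphi j)).
Qed.

(** Once [c] is required to equal the left-hand side, this is a linear system for [c] with matrix
    [I - G]; regularity of the partition is its unique solvability. *)
Lemma moment_pieces (p : 'I_k) lam c f : {within `[0, T], continuous f} ->
  \sum_(r < m) mxint (t r) (t r.+1) (fun u => psi p u *m piece A phi t X r (lam r) c f u) =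
  \sum_(r < m) (Psi p r + Wmx p r) *m lam r
  + \sum_(l < k) Gblock phi psi m t X p l *m c l + source_moment f p.
Proof.
move=> cf.
under eq_bigr => r _ do rewrite (moment_piece p (lam r) c (ltn_ord r) cf).
rewrite !big_split/=; congr (_ + _ + _).
rewrite exchange_big/=; apply: eq_bigr => l _.
by rewrite /Gblock mulmx_suml.
Qed.

(** The double sum in [Vmx] is [G] applied to [Psi]: the shape [w + G u] of the fixed-point
    lemma. *)
Lemma VmxE (p : 'I_k) r :
  Vmx A phi psi m t X p r = Wmx p r + \sum_(j < k) Gblock phi psi m t X p j *m Psi j r.
Proof.
rewrite /Vmx exchange_big/=; congr (_ + _); apply: eq_bigr => j _.
by rewrite /Gblock mulmx_suml.
Qed.

(** The fixed-point lemma with [u] made of the blocks [Psi lam] and [w] of the blocks [W lam + e].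
    From left to right it computes the moments of a given solution; from right to left it certifies
    that moments computed from [lam] are consistent. *)
Lemma moment_formula (reg : regular phi psi m t X) lam c (e : 'I_k -> 'cV[R]_n) :
  (forall p, c p = \sum_(r < m) (Psi p r + Wmx p r) *m lam r
     + \sum_(l < k) Gblock phi psi m t X p l *m c l + e p) <->
  (forall j, c j = \sum_(i < m)
      (\sum_(p < k) Mblock phi psi m t X j p *m Vmx A phi psi m t X p i + Psi j i) *m lam i
     + \sum_(p < k) Mblock phi psi m t X j p *m e p).
Proof.
pose C := \mxcol_j c j.
pose u := \mxcol_j (\sum_(i < m) Psi j i *m lam i).
pose w := \mxcol_j (\sum_(i < m) Wmx j i *m lam i + e j).
have fix_eq := @fixpoint_unitmx _ _ (Gmx phi psi m t X) C u w reg.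
have lhsE : u + w + Gmx phi psi m t X *m C = \mxcol_p (\sum_(r < m) (Psi p r + Wmx p r) *m lam r
     + \sum_(l < k) Gblock phi psi m t X p l *m c l + e p).
  rewrite /u /w /Gmx /C mul_mxblock_mxrow -!mxcolD; apply: eq_mxcol => p.
  under [in RHS]eq_bigr do rewrite mulmxDl.
  by rewrite big_split/= -!addrA; congr (_ + (_ + _)); exact: addrC.
move: fix_eq; have -> : w + Gmx phi psi m t X *m u =
    \mxcol_p (\sum_(i < m) Vmx A phi psi m t X p i *m lam i + e p).
  rewrite /u /w /Gmx mul_mxblock_mxrow -mxcolD; apply: eq_mxcol => p.
  under [in RHS]eq_bigr do rewrite VmxE mulmxDl.
  rewrite [in RHS]big_split/= addrAC; congr (_ + _ + _).
  under eq_bigr do rewrite mulmx_sumr.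
  rewrite exchange_big/=; apply: eq_bigr => i _; rewrite mulmx_suml.
  by apply: eq_bigr => j _; rewrite mulmxA.
have -> : invmx (1%:M - Gmx phi psi m t X) =
    \mxblock_(j, p) Mblock phi psi m t X j p by rewrite submxblockK.
have rhsE : u + \mxblock_(j, p) Mblock phi psi m t X j p *m
      \mxcol_p (\sum_(i < m) Vmx A phi psi m t X p i *m lam i + e p) =
    \mxcol_j (\sum_(i < m)
      (\sum_(p < k) Mblock phi psi m t X j p *m Vmx A phi psi m t X p i + Psi j i) *m lam i
     + \sum_(p < k) Mblock phi psi m t X j p *m e p).
  rewrite /u mul_mxblock_mxrow -mxcolD; apply: eq_mxcol => j.
  have -> : \sum_(p < k) Mblock phi psi m t X j p *m
        (\sum_(i < m) Vmx A phi psi m t X p i *m lam i + e p) =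
      \sum_(i < m) (\sum_(p < k) Mblock phi psi m t X j p *m Vmx A phi psi m t X p i) *m lam i
      + \sum_(p < k) Mblock phi psi m t X j p *m e p.
    under eq_bigr do rewrite mulmxDr mulmx_sumr.
    rewrite big_split/= exchange_big/=; congr (_ + _); apply: eq_bigr => i _.
    by rewrite mulmx_suml; apply: eq_bigr => p _; rewrite mulmxA.
  under [in RHS]eq_bigr do rewrite mulmxDl.
  by rewrite big_split/= addrA; congr (_ + _); exact: addrC.
rewrite rhsE lhsE => fix_eq.
split=> h; apply/mxcol_eqP.
  by apply: fix_eq.1; apply/mxcol_eqP.
by apply: fix_eq.2; apply/mxcol_eqP.
Qed.

End Parametrized_system.

(** * Continuity at the nodes and the multipoint condition as a system for [Qmx] *)

Section Matching_conditions.
Context {R : realType} {n k q m : nat} (T : R).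
Context (A : R -> 'M[R]_n) (phi psi : 'I_k -> R -> 'M[R]_n).
Context (s : 'I_q -> R) (B : 'I_q -> 'M[R]_n).
Context (t : nat -> R) (X : nat -> R -> 'M[R]_n).
Context (hT : 0 < T).
Context (hA : {within `[0, T], continuous A}).
Context (hphi : forall j, {within `[0, T], continuous (phi j)}).
Context (hpsi : forall j, {within `[0, T], continuous (psi j)}).
Context (part : is_partition T s m t).
Context (hX : forall r, (r < m)%N -> is_fundamental A (t r) (t r.+1) (X r)).
Implicit Types (f : R -> 'cV[R]_n) (c : 'I_k -> 'cV[R]_n) (lam : nat -> 'cV[R]_n).

Definition coefficient lam f (j : 'I_k) : 'cV[R]_n :=
  \sum_(i < m)
    (\sum_(p < k) Mblock phi psi m t X j p *m Vmx A phi psi m t X p i + Psi psi t j i) *m lam i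
  + \sum_(p < k) Mblock phi psi m t X j p *m source_moment (m := m) psi t X f p.

(** Influence of [f] alone on the end of the [r]-th piece: through the moments, and directly. *)
Definition load r f : 'cV[R]_n :=
  \sum_(j < k) XintX t X r (phi j) (t r.+1)
     *m (\sum_(p < k) Mblock phi psi m t X j p *m source_moment (m := m) psi t X f p)
  + duhamel_term t X r f (t r.+1).

Local Notation D := (Dmx A phi psi m t X).

Definition end_value lam f r : 'cV[R]_n := lam r + \sum_(i < m) D r i *m lam i + load r f.

(** Origin of [Dmx]: with the moments eliminated, [D r i] is the coefficient of [lam i] in the
    increment of the [r]-th piece over its subinterval. Its Kronecker term is the direct effect of
    the piece's own initial value through [A]. *)
Lemma piece_end lam f r : (r < m)%N -> {within `[0, T], continuous f} ->
  piece A phi t X r (lam r) (coefficient lam f) f (t r.+1) = end_value lam f r.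
Proof.
move=> rm cf.
have rr : t r <= t r.+1 <= t r.+1.
  by rewrite lexx andbT; apply: (partition_le part); rewrite leqnSn.
rewrite (pieceE hA hphi part hX (lam r) (coefficient lam f) rm rr cf).
rewrite /end_value /load -!addrA; congr (_ + _); rewrite !addrA; congr (_ + _).
rewrite /coefficient; under eq_bigr do rewrite mulmxDr.
rewrite big_split/= addrA; congr (_ + _); rewrite /Dmx.
under [in RHS]eq_bigr do rewrite mulmxDl.
rewrite [in RHS]big_split/= addrC; congr (_ + _).
  under [in RHS]eq_bigr do rewrite mulmx_suml.
  rewrite exchange_big/=; apply: eq_bigr => j _; rewrite mulmx_sumr.
  by apply: eq_bigr => i _; rewrite mulmxA.
rewrite (bigD1 (Ordinal rm))//= eqxx scale1r big1 ?addr0// => i ir.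
have -> : (r == i) = false.
  by apply/negbTE; apply: contra ir => /eqP ri; apply/eqP/val_inj.
by rewrite scale0r mul0mx.
Qed.

Lemma Qmx_row lam (p : 'I_m) :
  \sum_(i < m) Qblock A phi psi s B t X p i *m lam i =
  if p == 0%N :> nat then
    \sum_(i < m) Bpart s B t i *m lam i
      + Bpart s B t m *m (lam m.-1 + \sum_(i < m) D m.-1 i *m lam i)
  else lam p.-1 + \sum_(i < m) D p.-1 i *m lam i - lam p.
Proof.
have m0 := partition_gt0 part hT.
have pick (r : nat) (C : 'M[R]_n) : (r < m)%N ->
    \sum_(i < m) (i == r :> nat)%:R *: C *m lam i = C *m lam r.
  move=> rm; rewrite (bigD1 (Ordinal rm))//= eqxx scale1r big1 ?addr0// => i ir.
  have -> : (i == r :> nat) = false.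
    by apply/negbTE; apply: contra ir => /eqP ri; apply/eqP/val_inj.
  by rewrite scale0r mul0mx.
case: ifPn => p0.
  have -> : \sum_(i < m) Qblock A phi psi s B t X p i *m lam i =
      \sum_(i < m) (Bpart s B t i + (i == m.-1 :> nat)%:R *: Bpart s B t m
                    + Bpart s B t m *m D m.-1 i) *m lam i.
    apply: eq_bigr => i _; rewrite /Qblock p0; case: eqP => [->|_].
      by rewrite scale1r.
    by rewrite scale0r addr0.
  under eq_bigr do rewrite !mulmxDl.
  rewrite !big_split/= pick ?ltn_predL// -addrA mulmxDr; congr (_ + (_ + _)).
  by rewrite mulmx_sumr; apply: eq_bigr => i _; rewrite mulmxA.
have pm : (p.-1 < m)%N by rewrite (leq_ltn_trans (leq_pred p)).
(* For [p > 0] the columns [p.-1] and [p] are distinct, so the cases of [Qblock] can be written as a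
   sum of two indicators. *)
have pp : (p == p.-1 :> nat) = false.
  by case: (nat_of_ord p) p0 => // r _; rewrite /= gtn_eqF.
have -> : \sum_(i < m) Qblock A phi psi s B t X p i *m lam i =
    \sum_(i < m) ((i == p.-1 :> nat)%:R *: 1%:M + D p.-1 i
                  + (i == p :> nat)%:R *: (- 1%:M)) *m lam i.
  apply: eq_bigr => i _; rewrite /Qblock (negbTE p0); congr (_ *m _).
  have [ip|ip] := eqVneq (i : nat) p.-1.
    by rewrite ip [p.-1 == _]eq_sym pp scale1r scale0r addr0.
  rewrite scale0r add0r; have [->|ip'] := eqVneq i p.
    by rewrite eqxx scale1r opprB.
  have -> : (i == p :> nat) = false by apply: negbTE.
  by rewrite scale0r addr0.
under eq_bigr do rewrite 2!mulmxDl.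
by rewrite !big_split/= !pick// mul1mx mulNmx mul1mx.
Qed.

Definition Qrhs f (d : 'cV[R]_n) : 'cV[R]_(\sum_(i < m) n) :=
  \mxcol_(p < m) (if p == 0%N :> nat then d - Bpart s B t m *m load m.-1 f
                  else - load p.-1 f).

(** End values are affine in [lam]; [Qrhs] collects their constant parts with opposite sign, so the
    linear system restates the matching conditions row by row. *)
Lemma Qmx_system lam f d :
  Qmx A phi psi s B m t X *m \mxcol_(i < m) lam i = Qrhs f d <->
  \sum_(i < m) Bpart s B t i *m lam i + Bpart s B t m *m end_value lam f m.-1 = d /\
  (forall r, (r.+1 < m)%N -> end_value lam f r = lam r.+1).
Proof.
have m0 := partition_gt0 part hT.
rewrite /Qmx mul_mxblock_mxrow /Qrhs.
split=> [/mxcol_eqP h|[h0 h1]].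
  split=> [|r rm].
    have := h (Ordinal m0); rewrite Qmx_row/= => /eqP; rewrite eq_sym subr_eq => /eqP->.
    by rewrite /end_value mulmxDr addrA.
  have := h (Ordinal rm); rewrite Qmx_row/= => /eqP; rewrite subr_eq => /eqP e.
  by rewrite /end_value e addrAC addNr add0r.
apply/mxcol_eqP => p; rewrite Qmx_row; case: ifPn => p0.
  by rewrite -h0 /end_value [Bpart _ _ _ _ *m (_ + load _ _)]mulmxDr addrA addrK.
have pS : (p.-1).+1 = p by rewrite prednK// lt0n.
have := h1 p.-1; rewrite pS ltn_ord => /(_ isT) <-.
by rewrite /end_value opprD addrA subrr add0r.
Qed.

End Matching_conditions.

(** * Correspondence between solutions and their node values *)

Section Node_values.
Context {R : realType} {n k q m : nat} (T : R).
Context (A : R -> 'M[R]_n) (phi psi : 'I_k -> R -> 'M[R]_n).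
Context (s : 'I_q -> R) (B : 'I_q -> 'M[R]_n).
Context (t : nat -> R) (X : nat -> R -> 'M[R]_n).
Context (hT : 0 < T).
Context (hA : {within `[0, T], continuous A}).
Context (hphi : forall j, {within `[0, T], continuous (phi j)}).
Context (hpsi : forall j, {within `[0, T], continuous (psi j)}).
Context (part : is_partition T s m t).
Context (hX : forall r, (r < m)%N -> is_fundamental A (t r) (t r.+1) (X r)).
Implicit Types (f : R -> 'cV[R]_n) (c : 'I_k -> 'cV[R]_n) (lam : nat -> 'cV[R]_n).

Context (hs : forall l, 0 <= s l <= T).
Context (reg : regular phi psi m t X).

Local Notation coef := (coefficient (m := m) A phi psi t X).
Local Notation Qm := (Qmx A phi psi s B m t X).
Local Notation Qr := (Qrhs (m := m) phi psi s B t X).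

(** The moment formula makes [coef] consistent and the rows of [Qmx] make neighbouring pieces agree,
    so the pieces glue. This holds on every regular partition, whatever its mesh, as the forward
    implication requires. *)
Lemma system_solution lam f d : {within `[0, T], continuous f} ->
  Qm *m \mxcol_(i < m) lam i = Qr f d ->
  exists x, [/\ {within `[0, T], continuous x}, integral_equation T A phi psi f x,
    \sum_(l < q) B l *m x (s l) = d &
    forall r u, (r < m)%N -> t r <= u <= t r.+1 ->
      x u = piece A phi t X r (lam r) (coef lam f) f u].
Proof.
move=> cf /(Qmx_system A phi psi B X hT part)[e0 e1].
have m0 := partition_gt0 part hT; have [_ tm _ _] := part.
have pe r : (r < m)%N ->
    piece A phi t X r (lam r) (coef lam f) f (t r.+1) = end_value (m := m) A phi psi t X lam f r.
  by move=> rm; exact: (piece_end psi hA hphi part hX lam rm cf).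
have [||x [cx ex xp]] := @glued_solution _ _ _ _ _ T A phi psi s t X hT hA hphi hpsi
    part hX lam (coef lam f) f cf.
- by move=> r rm; rewrite pe ?e1// ltnW.
- move=> j; rewrite (moment_pieces hA hphi hpsi part hX j lam (coef lam f) cf).
  by move: j; apply/(moment_formula A reg).
have rr r : (r < m)%N -> t r <= t r.+1.
  by move=> rm; apply: (partition_le part); rewrite leqnSn.
exists x; split=> //; rewrite (Bpart_sum part) big_ord_recr/= -e0; congr (_ + _).
  apply: eq_bigr => i _; rewrite (xp i (t i) (ltn_ord i)) ?piece_start//.
  by rewrite lexx rr.
rewrite -[X in x (t X)](prednK m0) (xp m.-1) ?pe ?ltn_predL//.
by rewrite lexx rr ?ltn_predL.
Qed.

Lemma zero_integral_equation :
  integral_equation T A phi psi (fun=> 0) (fun=> 0 : 'cV[R]_n).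
Proof.
move=> u _; rewrite add0r -[LHS](mxint_cst0 0 u); apply: eq_mxint => v _.
have mom j : moment T psi (fun=> 0 : 'cV[R]_n) j = 0.
  by rewrite /moment -[RHS](mxint_cst0 0 T); apply: eq_mxint => w _; rewrite mulmx0.
by rewrite mulmx0 /source big1 ?addr0// => j _; rewrite mom mulmx0.
Qed.

Lemma duhamel_term0 p r u : duhamel_term t X r (fun=> 0 : 'M[R]_(n, p)) u = 0.
Proof.
rewrite /duhamel_term (@eq_mxint _ _ _ _ _ _ (fun=> 0)) ?mxint_cst0 ?mulmx0//.
by move=> v _; rewrite mulmx0.
Qed.

Lemma Qrhs0 : Qr (fun=> 0) 0 = 0.
Proof.
have mom p : source_moment (m := m) psi t X (fun=> 0) p = 0.
  rewrite /source_moment big1// => r _; rewrite -[RHS](mxint_cst0 (t r) (t r.+1)).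
  by apply: eq_mxint => v _; rewrite duhamel_term0 mulmx0.
have load0 r : load (m := m) phi psi t X r (fun=> 0) = 0.
  rewrite /load duhamel_term0 addr0 big1// => j _; rewrite big1 ?mulmx0// => p _.
  by rewrite mom mulmx0.
apply/mxcolP => p; rewrite mxcolK submxcol0 load0 mulmx0 subr0.
by case: ifP => // _; rewrite load0 oppr0.
Qed.

Lemma well_posed_Qmx_unit : well_posed T A phi psi s B -> Qm \in unitmx.
Proof.
case=> K wp; apply: unitmx_inj => v Qv0.
pose lam := nat_blocks v; have lamE : \mxcol_(i < m) lam i = v := nat_blocksK v.
have c0 : {within `[0, T], continuous (fun=> 0 : 'cV[R]_n)}.
  exact: within_continuous_cst.
have [|x [cx ex Bx xp]] := @system_solution lam (fun=> 0) 0 c0.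
  by rewrite lamE Qv0 Qrhs0.
have [y sol_y yx] := integral_equation_solution B hA hphi hpsi hs c0 cx ex.
(* A second solution with the same data, built from the zero function, against which uniqueness
   compares [y]. *)
have [z sol_z z0] :=
  integral_equation_solution B hA hphi hpsi hs c0 c0 zero_integral_equation.
rewrite Bx in sol_y.
have B0 : \sum_(l < q) B l *m (0 : 'cV[R]_n) = 0.
  by rewrite big1// => l _; rewrite mulmx0.
rewrite B0 in sol_z.
have [w [_ uniq_w _]] := wp (fun=> 0) 0 c0.
have x0 u : 0 <= u <= T -> x u = 0.
  by move=> uT; rewrite -(yx u uT) (uniq_w y sol_y u uT) -(uniq_w z sol_z u uT) z0.
rewrite -lamE -[RHS]mxcol0; apply: eq_mxcol => i.
have im := ltn_ord i.
have rr : t i <= t i.+1 by apply: (partition_le part); rewrite leqnSn.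
(* Each block is the starting value of its piece, hence a value of [x] on [[0, T]]. *)
rewrite -(piece_start A phi t X i (lam i) (coef lam (fun=> 0)) (fun=> 0)).
rewrite -(xp i (t i) im) ?lexx// x0//.
by rewrite (partition_ge0 part (ltnW im)) (partition_leT part (ltnW im)).
Qed.

Context (M : R) (M0 : 0 <= M) (AM : forall u : R, 0 <= u <= T -> `|A u| <= M).
Context (short : forall r, (r < m)%N -> n%:R * M * (t r.+1 - t r) <= 1 / 2).

(** Converse of [system_solution]: short steps identify a given solution with its Duhamel pieces, so
    its moments satisfy the moment system and equal [coef]. *)
Lemma solution_system x f : {within `[0, T], continuous f} ->
  {within `[0, T], continuous x} -> integral_equation T A phi psi f x ->
  Qm *m \mxcol_(i < m) x (t i) = Qr f (\sum_(l < q) B l *m x (s l)) /\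
  forall r u, (r < m)%N -> t r <= u <= t r.+1 ->
    x u = piece A phi t X r (x (t r)) (coef (x \o t) f) f u.
Proof.
move=> cf cx ex; have m0 := partition_gt0 part hT.
have xp r u : (r < m)%N -> t r <= u <= t r.+1 ->
    x u = piece A phi t X r (x (t r)) (moment T psi x) f u.
  move=> rm; exact: (solution_piece hA hphi part hX M0 cf cx ex rm AM (short rm)).
have mom : moment T psi x = coef (x \o t) f.
  apply/funext; apply/(moment_formula A reg) => p.
  rewrite -(moment_pieces hA hphi hpsi part hX p (x \o t) (moment T psi x) cf).
  rewrite {1}/moment (mxint_partition part); last exact: moment_integrand_continuous.
  by apply: eq_bigr => r _; apply: eq_mxint => u ru; rewrite [in LHS](xp r).
rewrite mom in xp; split; last exact: xp.
have rr r : (r < m)%N -> t r <= t r.+1.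
  by move=> rm; apply: (partition_le part); rewrite leqnSn.
have ev r : (r < m)%N -> end_value (m := m) A phi psi t X (x \o t) f r = x (t r.+1).
  move=> rm; rewrite -(piece_end psi hA hphi part hX (x \o t) rm cf) -xp//.
  by rewrite lexx rr.
apply/(Qmx_system A phi psi B X hT part (x \o t) f); split=> [|r rm]; last by rewrite ev// ltnW.
by rewrite ev ?ltn_predL// prednK// (Bpart_sum part) big_ord_recr.
Qed.

(** Invertibility of [Qmx] determines the node values, these determine the moments, and both
    together determine every piece. *)
Lemma unique_solution x y f : Qm \in unitmx -> {within `[0, T], continuous f} ->
  {within `[0, T], continuous x} -> integral_equation T A phi psi f x ->
  {within `[0, T], continuous y} -> integral_equation T A phi psi f y ->
  \sum_(l < q) B l *m x (s l) = \sum_(l < q) B l *m y (s l) ->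
  forall u, 0 <= u <= T -> x u = y u.
Proof.
move=> uQ cf cx ex cy ey Bxy u uT.
have [Qx xp] := solution_system cf cx ex; have [Qy yp] := solution_system cf cy ey.
have nodes i : (i < m)%N -> x (t i) = y (t i).
  move=> im; have /mxcol_eqP/(_ (Ordinal im)) : \mxcol_(i < m) x (t i) = \mxcol_(i < m) y (t i).
    by rewrite -[LHS](mulKmx uQ) Qx Bxy -Qy mulKmx.
  exact.
have [r rm ru] := partition_cover part hT uT.
have coefE : coef (x \o t) f = coef (y \o t) f.
  apply/funext => j; rewrite /coefficient; congr (_ + _).
  by apply: eq_bigr => i _; rewrite /= (nodes i (ltn_ord i)).
by rewrite (xp r u rm ru) (yp r u rm ru) (nodes r rm) coefE.
Qed.

End Node_values.

(** * Existence of a regular partition with short steps *)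

Section Regular_partition.
Context {R : realType} {n k q : nat} (T : R).
Context (A : R -> 'M[R]_n) (phi psi : 'I_k -> R -> 'M[R]_n) (s : 'I_q -> R).
Context (hT : 0 < T).
Context (hA : {within `[0, T], continuous A}).
Context (hphi : forall j, {within `[0, T], continuous (phi j)}).
Context (hpsi : forall j, {within `[0, T], continuous (psi j)}).

Lemma within_continuous_bounded p p' (F : R -> 'M[R]_(p, p')) :
  {within `[0, T], continuous F} ->
  exists2 C : R, 0 <= C & forall u, 0 <= u <= T -> `|F u| <= C.
Proof.
move=> cF; have [c _ hc] := norm_attains_max (ltW hT) cF.
by exists `|F c|; first exact: normr_ge0.
Qed.

Lemma family_bounded p p' (I : finType) (F : I -> R -> 'M[R]_(p, p')) :
  (forall i, {within `[0, T], continuous (F i)}) ->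
  exists2 C : R, 0 <= C & forall i u, 0 <= u <= T -> `|F i u| <= C.
Proof.
move=> cF; have /boolp.choice[C hC] : forall i, exists C : R,
    0 <= C /\ forall u, 0 <= u <= T -> `|F i u| <= C.
  by move=> i; have [C C0 hC] := within_continuous_bounded (@cF i); exists C.
exists (\sum_i C i) => [|i u uT]; first by apply: sumr_ge0 => i _; exact: (hC i).1.
apply: le_trans ((hC i).2 u uT) _; rewrite (bigD1 i)//= lerDl.
by apply: sumr_ge0 => j _; exact: (hC j).1.
Qed.

Section Short_partition.
Context {m : nat} (t : nat -> R) (X : nat -> R -> 'M[R]_n).
Context (part : is_partition T s m t).
Context (hX : forall r, (r < m)%N -> is_fundamental A (t r) (t r.+1) (X r)).
Context (M : R) (M0 : 0 <= M) (AM : forall u : R, 0 <= u <= T -> `|A u| <= M).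
Context (short : forall r, (r < m)%N -> n%:R * M * (t r.+1 - t r) <= 1 / 2).

Lemma piece_in_domain r u : (r < m)%N -> t r <= u <= t r.+1 -> 0 <= u <= T.
Proof.
move=> rm /andP[ru ur]; rewrite (le_trans (partition_ge0 part (ltnW rm)) ru).
exact: le_trans ur (partition_leT part rm).
Qed.

(** Obtained from the integral equation of the Duhamel term, not from its formula, so no norm of [X]
    or of its inverse enters. The mesh can thus be fixed before [X] is known. *)
Lemma duhamel_term_bound p r (F : R -> 'M[R]_(n, p)) (c : R) : 0 <= c -> (r < m)%N ->
  {within `[0, T], continuous F} -> (forall u, 0 <= u <= T -> `|F u| <= c) ->
  forall u, t r <= u <= t r.+1 -> `|duhamel_term t X r F u| <= 2 * c * (t r.+1 - t r).
Proof.
move=> c0 rm cF Fc u ru.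
have [cS eS] := duhamel_termE hA part hX rm cF.
have rr : t r <= t r.+1 by apply: (partition_le part); rewrite leqnSn.
have cA' := within_continuous_piece part rm hA.
have cF' := within_continuous_piece part rm cF.
apply: (@short_interval_bound _ n (t r) (t r.+1) p A (duhamel_term t X r F) F M c M0 c0 rr
  (short rm) cA' cS cF' _ _ eS u ru).
- by move=> v /(piece_in_domain rm)/AM.
- by move=> v /(piece_in_domain rm)/Fc.
Qed.

(** One factor [t r.+1 - t r] comes from the Duhamel term, the other from the outer integral. Summed
    over the partition, one adds up to [T] and the other makes [G] small with the mesh. *)
Lemma psi_duhamel_bound p r (j : 'I_k) (F : R -> 'M[R]_(n, p)) (c C : R) :
  0 <= c -> 0 <= C -> (r < m)%N ->
  {within `[0, T], continuous F} -> (forall u, 0 <= u <= T -> `|F u| <= c) ->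
  (forall u, 0 <= u <= T -> `|psi j u| <= C) ->
  `|mxint (t r) (t r.+1) (fun u => psi j u *m duhamel_term t X r F u)| <=
  n%:R * C * (2 * c * (t r.+1 - t r)) * (t r.+1 - t r).
Proof.
move=> c0 C0 rm cF Fc psiC.
have rr : t r <= t r.+1 by apply: (partition_le part); rewrite leqnSn.
have d0 : 0 <= t r.+1 - t r by rewrite subr_ge0.
apply: mxint_norm_le rr _ _ _; first by rewrite !mulr_ge0.
  exact: (@psi_duhamel_continuous _ _ _ _ _ T A psi s t X hA hpsi part hX _ j r F rm cF).
move=> u ru; apply: le_trans (mx_norm_mul _ _) _; rewrite -!mulrA ler_wpM2l//.
apply: ler_pM; [exact: normr_ge0|exact: normr_ge0|exact: psiC (piece_in_domain rm ru)|].
by rewrite mulrA; exact: duhamel_term_bound.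
Qed.

Lemma partition_length : \sum_(r < m) (t r.+1 - t r) = T.
Proof.
have [t0 tm _ _] := part.
rewrite -(big_mkord xpredT (fun r => t r.+1 - t r)) telescope_sumr// tm t0.
by rewrite subr0.
Qed.

Lemma Gblock_bound (C c d : R) p l : 0 <= C -> 0 <= c ->
  (forall u, 0 <= u <= T -> `|psi p u| <= C) ->
  (forall u, 0 <= u <= T -> `|phi l u| <= c) ->
  (forall r, (r < m)%N -> t r.+1 - t r <= d) ->
  `|Gblock phi psi m t X p l| <= n%:R * C * (2 * c * d) * T.
Proof.
move=> C0 c0 psiC phic td; rewrite -partition_length mulr_sumr /Gblock.
apply: le_trans (ler_norm_sum _ _ _) _; apply: ler_sum => r _.
apply: le_trans (psi_duhamel_bound c0 C0 (ltn_ord r) (@hphi l) phic psiC) _.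
have d0 : 0 <= t r.+1 - t r.
  by rewrite subr_ge0; apply: (partition_le part); rewrite leqnSn ltn_ord.
by rewrite ler_wpM2r// ler_wpM2l ?mulr_ge0// ler_wpM2l ?mulr_ge0// td.
Qed.

Lemma regular_of_small_blocks (e : R) : 0 <= e ->
  (forall p l, `|Gblock phi psi m t X p l| <= e) ->
  (\sum_(i < k) n)%:R * e < 1 -> regular phi psi m t X.
Proof.
move=> e0 Ge small; rewrite /regular; apply: small_perturbation_unit.
rewrite normrN; apply: le_lt_trans _ small; rewrite ler_wpM2l//.
apply/mx_norm_leP => // i j; rewrite /Gmx mxE.
exact: le_trans (mx_norm_entry _ _ _) (Ge _ _).
Qed.

End Short_partition.

Lemma regular_partition : (forall l, 0 <= s l <= T) ->
  exists m t X M, [/\ is_partition T s m t,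
    forall r, (r < m)%N -> is_fundamental A (t r) (t r.+1) (X r),
    regular phi psi m t X,
    0 <= M /\ (forall u : R, 0 <= u <= T -> `|A u| <= M) &
    forall r, (r < m)%N -> n%:R * M * (t r.+1 - t r) <= 1 / 2].
Proof.
move=> hs; have [M M0 AM] := within_continuous_bounded hA.
have [C C0 psiC] := family_bounded hpsi; have [c c0 phic] := family_bounded hphi.
pose N : R := (\sum_(i < k) n)%:R; have N0 : 0 <= N by exact: ler0n.
have n0 : 0 <= (n%:R : R) by exact: ler0n.
(* [a * d <= 1] is the bound 1/4 required by the Picard iteration; [b * d < 1] keeps the order of
   [Gmx] times the bound on its blocks below 1. The summand 1 in the denominator of [d] makes the
   latter strict. *)
pose a : R := 4 * (n%:R * M); have a0 : 0 <= a by rewrite !mulr_ge0.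
pose b : R := N * (n%:R * C * (2 * c) * T); have b0 : 0 <= b.
  by rewrite !mulr_ge0// ltW.
pose d := (1 + a + b)^-1.
have ab0 : 0 < 1 + a + b by rewrite ltr_pwDl// ltr_pwDl.
have d0 : 0 < d by rewrite invr_gt0.
have ad : a * d <= 1 by rewrite ler_pdivrMr// mul1r; lra.
have bd : b * d < 1 by rewrite ltr_pdivrMr// mul1r; lra.
have [m [t [part td]]] := fine_partition hT d0 hs.
have short r : (r < m)%N -> n%:R * M * (t r.+1 - t r) <= 1 / 4.
  move=> rm; have : n%:R * M * (t r.+1 - t r) <= n%:R * M * d.
    by rewrite ler_wpM2l ?mulr_ge0// td.
  by move: ad; rewrite /a; lra.
have /boolp.choice[X hX] : forall r, exists X, (r < m)%N -> is_fundamental A (t r) (t r.+1) X.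
  move=> r; have [rm|_] := boolP (r < m)%N; last by exists (fun=> 0).
  have rr : t r <= t r.+1 by apply: (partition_le part); rewrite leqnSn.
  have AM' u : t r <= u <= t r.+1 -> `|A u| <= M.
    by move=> ru; apply: AM; exact: (piece_in_domain part rm ru).
  have [X hX] := short_interval_fundamental M0 rr (short r rm)
    (within_continuous_piece part rm hA) AM'.
  by exists X.
have short2 r : (r < m)%N -> n%:R * M * (t r.+1 - t r) <= 1 / 2.
  by move=> /short h; apply: le_trans h _; lra.
exists m, t, X, M; split=> //.
apply: (@regular_of_small_blocks _ _ _ (n%:R * C * (2 * c * d) * T)).
- by rewrite !mulr_ge0// ltW.
- move=> p l.
  exact: (Gblock_bound part hX M0 AM short2 C0 c0 (psiC p) (phic l) td).
- by move: bd; rewrite /b /N !mulrA; congr (_ < _); rewrite -!mulrA; congr (_ * _); ring.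
Qed.

End Regular_partition.

(** * The a priori estimate and well-posedness from one partition *)

Section A_priori_bound.
Context {R : realType} {n k q m : nat} (T : R).
Context (A : R -> 'M[R]_n) (phi psi : 'I_k -> R -> 'M[R]_n).
Context (s : 'I_q -> R) (B : 'I_q -> 'M[R]_n).
Context (t : nat -> R) (X : nat -> R -> 'M[R]_n).
Context (hT : 0 < T).
Context (hA : {within `[0, T], continuous A}).
Context (hphi : forall j, {within `[0, T], continuous (phi j)}).
Context (hpsi : forall j, {within `[0, T], continuous (psi j)}).
Context (hs : forall l, 0 <= s l <= T).
Context (part : is_partition T s m t).
Context (hX : forall r, (r < m)%N -> is_fundamental A (t r) (t r.+1) (X r)).
Context (reg : regular phi psi m t X).
Context (M : R) (M0 : 0 <= M) (AM : forall u : R, 0 <= u <= T -> `|A u| <= M).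
Context (short : forall r, (r < m)%N -> n%:R * M * (t r.+1 - t r) <= 1 / 2).

Local Notation coef := (coefficient (m := m) A phi psi t X).
Local Notation Qm := (Qmx A phi psi s B m t X).
Local Notation Qr := (Qrhs (m := m) phi psi s B t X).

(** A class of maps stable under the operations that build a solution from [(f, d)], so that the
    constant need not be computed. Any common bound [N] of the data is allowed, which keeps suprema
    out until the end. *)
Definition bounded_in_data p (w : (R -> 'cV[R]_n) -> 'cV[R]_n -> 'cV[R]_p) :=
  exists2 K : R, 0 <= K & forall f d (N : R), {within `[0, T], continuous f} ->
    0 <= N -> (forall u, 0 <= u <= T -> `|f u| <= N) -> `|d| <= N -> `|w f d| <= K * N.

Lemma bounded_in_dataD p (w w' : (R -> 'cV[R]_n) -> 'cV[R]_n -> 'cV[R]_p) :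
  bounded_in_data w -> bounded_in_data w' ->
  bounded_in_data (fun f d => w f d + w' f d).
Proof.
move=> [K K0 hK] [K' K0' hK']; exists (K + K'); first by rewrite addr_ge0.
move=> f d N cf N0 fN dN; rewrite mulrDl.
apply: le_trans (ler_normD _ _) (lerD _ _); [exact: hK|exact: hK'].
Qed.

Lemma bounded_in_dataN p (w : (R -> 'cV[R]_n) -> 'cV[R]_n -> 'cV[R]_p) :
  bounded_in_data w -> bounded_in_data (fun f d => - w f d).
Proof.
move=> [K K0 hK]; exists K => // f d N cf N0 fN dN; rewrite normrN; exact: hK.
Qed.

Lemma bounded_in_data0 p : bounded_in_data (fun _ _ => 0 : 'cV[R]_p).
Proof. by exists 0 => // f d N _ _ _ _; rewrite normr0 mul0r. Qed.

Lemma bounded_in_data_sum p (I : Type) (l : seq I)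
    (w : I -> (R -> 'cV[R]_n) -> 'cV[R]_n -> 'cV[R]_p) :
  (forall i, bounded_in_data (w i)) ->
  bounded_in_data (fun f d => \sum_(i <- l) w i f d).
Proof.
move=> h; elim: l => [|i l IH].
  by have [K K0 hK] := bounded_in_data0 p; exists K => // f d N; rewrite big_nil; exact: hK.
have [K K0 hK] := bounded_in_dataD (h i) IH.
by exists K => // f d N; rewrite big_cons; exact: hK.
Qed.

Lemma bounded_in_dataM p p' (C : 'M[R]_(p', p))
    (w : (R -> 'cV[R]_n) -> 'cV[R]_n -> 'cV[R]_p) :
  bounded_in_data w -> bounded_in_data (fun f d => C *m w f d).
Proof.
move=> [K K0 hK]; exists (p%:R * `|C| * K); first by rewrite !mulr_ge0.
move=> f d N cf N0 fN dN; apply: le_trans (mx_norm_mul _ _) _.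
by rewrite -[leRHS]mulrA ler_wpM2l ?mulr_ge0//; exact: hK.
Qed.

Lemma bounded_in_data_family p (I : finType)
    (w : I -> (R -> 'cV[R]_n) -> 'cV[R]_n -> 'cV[R]_p) :
  (forall i, bounded_in_data (w i)) ->
  exists2 K : R, 0 <= K & forall i f d (N : R), {within `[0, T], continuous f} ->
    0 <= N -> (forall u, 0 <= u <= T -> `|f u| <= N) -> `|d| <= N -> `|w i f d| <= K * N.
Proof.
move=> h; have /boolp.choice[K hK] : forall i, exists K : R, 0 <= K /\
    forall f d (N : R), {within `[0, T], continuous f} ->
    0 <= N -> (forall u, 0 <= u <= T -> `|f u| <= N) -> `|d| <= N -> `|w i f d| <= K * N.
  by move=> i; have [K K0 hK] := h i; exists K.
exists (\sum_i K i) => [|i f d N cf N0 fN dN].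
  by apply: sumr_ge0 => i _; exact: (hK i).1.
apply: le_trans ((hK i).2 f d N cf N0 fN dN) _.
rewrite ler_wpM2r// (bigD1 i)//= lerDl.
by apply: sumr_ge0 => j _; exact: (hK j).1.
Qed.

Lemma bounded_in_data_mxcol p m' (w : 'I_m' -> (R -> 'cV[R]_n) -> 'cV[R]_n -> 'cV[R]_p) :
  (forall i, bounded_in_data (w i)) ->
  bounded_in_data (fun f d => \mxcol_i w i f d).
Proof.
move=> /bounded_in_data_family[K K0 hK]; exists K => // f d N cf N0 fN dN.
apply/mx_norm_leP => [|i j]; first by rewrite mulr_ge0.
rewrite mxE; exact: le_trans (mx_norm_entry _ _ _) (hK _ _ _ _ cf N0 fN dN).
Qed.

Lemma bounded_in_data_block p m' (w : (R -> 'cV[R]_n) -> 'cV[R]_n -> 'cV[R]_(\sum_(i < m') p)) i :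
  bounded_in_data w -> bounded_in_data (fun f d => nat_blocks (w f d) i).
Proof.
move=> [K K0 hK]; exists K => // f d N cf N0 fN dN.
apply: le_trans (hK f d N cf N0 fN dN); rewrite /nat_blocks.
case: insubP => [j _ _|_]; last by rewrite normr0.
apply/mx_norm_leP => // a b; rewrite mxE; exact: mx_norm_entry.
Qed.

Lemma bounded_datum : bounded_in_data (fun _ d => d).
Proof. by exists 1 => // f d N _ _ _; rewrite mul1r. Qed.

Lemma bounded_source_moment p :
  bounded_in_data (fun f _ => source_moment (m := m) psi t X f p).
Proof.
have [C C0 psiC] := within_continuous_bounded hT (@hpsi p).
apply: bounded_in_data_sum => r.
have rr : 0 <= t r.+1 - t r.
  by rewrite subr_ge0; apply: (partition_le part); rewrite leqnSn ltn_ord.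
exists (n%:R * C * (2 * (t r.+1 - t r)) * (t r.+1 - t r)); first by rewrite !mulr_ge0.
move=> f d N cf N0 fN _.
apply: le_trans (psi_duhamel_bound hA hpsi part hX M0 AM short N0 C0 (ltn_ord r) cf fN psiC) _.
by rewrite le_eqVlt; apply/orP; left; apply/eqP; ring.
Qed.

Lemma bounded_load r : (r < m)%N ->
  bounded_in_data (fun f _ => load (m := m) phi psi t X r f).
Proof.
move=> rm; have rr : t r <= t r.+1 by apply: (partition_le part); rewrite leqnSn.
apply: bounded_in_dataD.
  apply: bounded_in_data_sum => j; apply: bounded_in_dataM.
  apply: bounded_in_data_sum => p; apply: bounded_in_dataM; exact: bounded_source_moment.
exists (2 * (t r.+1 - t r)); first by rewrite mulr_ge0 ?subr_ge0.
move=> f d N cf N0 fN _; rewrite mulrAC.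
by apply: (duhamel_term_bound hA part hX M0 AM short N0 rm cf fN); rewrite rr lexx.
Qed.

Lemma bounded_Qrhs : bounded_in_data Qr.
Proof.
apply: bounded_in_data_mxcol => p.
have pm : (p.-1 < m)%N by rewrite (leq_ltn_trans (leq_pred p)).
have lm : (m.-1 < m)%N by rewrite ltn_predL (partition_gt0 part hT).
case: (p == 0%N :> nat).
  apply: bounded_in_dataD bounded_datum _; apply: bounded_in_dataN.
  by apply: bounded_in_dataM; exact: bounded_load.
by apply: bounded_in_dataN; exact: bounded_load.
Qed.

Lemma bounded_coefficient (lam : (R -> 'cV[R]_n) -> 'cV[R]_n -> nat -> 'cV[R]_n) j :
  (forall i, bounded_in_data (fun f d => lam f d i)) ->
  bounded_in_data (fun f d => coef (lam f d) f j).
Proof.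
move=> blam; apply: bounded_in_dataD; apply: bounded_in_data_sum => i.
  exact: bounded_in_dataM.
by apply: bounded_in_dataM; exact: bounded_source_moment.
Qed.

Lemma bounded_piece (lam : (R -> 'cV[R]_n) -> 'cV[R]_n -> nat -> 'cV[R]_n) :
  (forall i, bounded_in_data (fun f d => lam f d i)) ->
  exists2 K : R, 0 <= K & forall f d (N : R), {within `[0, T], continuous f} ->
    0 <= N -> (forall u, 0 <= u <= T -> `|f u| <= N) -> `|d| <= N ->
    forall r u, (r < m)%N -> t r <= u <= t r.+1 ->
      `|piece A phi t X r (lam f d r) (coef (lam f d) f) f u| <= K * N.
Proof.
move=> blam.
have [K1 K10 hK1] := bounded_in_data_family (fun i : 'I_m => blam i).
have [K2 K20 hK2] := bounded_in_data_family (fun j : 'I_k => bounded_coefficient j blam).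
have [c c0 phic] := family_bounded hT hphi.
(* [L * N] bounds the forcing of a piece; the summands come from [A lam], from the moments, and from
   [f] itself. *)
pose L : R := n%:R * M * K1 + (\sum_(j < k) n%:R * c * K2 + 1).
have S0 : 0 <= \sum_(j < k) n%:R * c * K2 by apply: sumr_ge0 => j _; rewrite !mulr_ge0.
have L0 : 0 <= L by rewrite addr_ge0 ?addr_ge0// !mulr_ge0.
exists (K1 + 2 * L * T); first by rewrite addr_ge0// !mulr_ge0// ltW.
move=> f d N cf N0 fN dN r u rm ru.
have rr : t r <= t r.+1 by apply: (partition_le part); rewrite leqnSn.
rewrite mulrDl; apply: le_trans (ler_normD _ _) (lerD _ _).
  exact: (hK1 (Ordinal rm) f d N cf N0 fN dN).
have LN0 : 0 <= L * N by rewrite mulr_ge0.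
have cs := @piece_source_continuous _ _ _ T A phi hA hphi (lam f d r) (coef (lam f d) f) f cf.
apply: le_trans (duhamel_term_bound hA part hX M0 AM short LN0 rm cs _ ru) _; last first.
  have trT : t r.+1 - t r <= T.
    by rewrite lerBlDr (le_trans (partition_leT part rm))// lerDl (partition_ge0 part (ltnW rm)).
  have -> : 2 * L * T * N = 2 * (L * N) * T by ring.
  by rewrite ler_wpM2l// mulr_ge0.
move=> v vT; rewrite /L mulrDl; apply: le_trans (ler_normD _ _) (lerD _ _).
  apply: le_trans (mx_norm_mul _ _) _; rewrite -!mulrA ler_wpM2l//.
  apply: ler_pM; [exact: normr_ge0|exact: normr_ge0|exact: AM|].
  exact: (hK1 (Ordinal rm) f d N cf N0 fN dN).
rewrite mulrDl mul1r; apply: le_trans (ler_normD _ _) (lerD _ (fN v vT)).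
rewrite mulr_suml; apply: le_trans (ler_norm_sum _ _ _) _; apply: ler_sum => j _.
apply: le_trans (mx_norm_mul _ _) _; rewrite -!mulrA ler_wpM2l//.
apply: ler_pM; [exact: normr_ge0|exact: normr_ge0|exact: phic|].
exact: (hK2 j f d N cf N0 fN dN).
Qed.

(** [sup] dominates the values once the set is bounded above, which continuity on [[0, T]]
    ensures. *)
Lemma norm1_bound p (f : R -> 'cV[R]_p) u : {within `[0, T], continuous f} ->
  0 <= u <= T -> `|f u| <= norm1 T f.
Proof.
move=> cf uT; have [C _ fC] := within_continuous_bounded hT cf.
apply: sup_upper_bound; last by exists u => //=; rewrite in_itv.
split; first by exists `|f u|, u => //=; rewrite in_itv.
by exists C => z [v vI <-{z}]; apply: fC; move: vI; rewrite /= in_itv.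
Qed.

Lemma Qmx_unit_well_posed : Qm \in unitmx -> well_posed T A phi psi s B.
Proof.
(* [lam] is taken as a function of the data, so that [K] is fixed before [f] and [d]. *)
move=> uQ; pose lam f d := nat_blocks (invmx Qm *m Qr f d).
have blam i : bounded_in_data (fun f d => lam f d i).
  by apply: bounded_in_data_block; apply: bounded_in_dataM; exact: bounded_Qrhs.
have [K K0 hK] := bounded_piece blam.
exists K => f d cf.
have Qlam : Qm *m \mxcol_(i < m) lam f d i = Qr f d by rewrite nat_blocksK mulKVmx.
have [x [cx ex Bx xp]] := system_solution hT hA hphi hpsi part hX reg cf Qlam.
have [y sol_y yx] := integral_equation_solution B hA hphi hpsi hs cf cx ex.
rewrite Bx in sol_y; exists y; split; first exact: sol_y.
- move=> z sol_z u uT; have [cz _ _ Bz] := sol_z.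
  have ez := solution_integral_equation hA hphi hpsi cf sol_z.
  rewrite (yx u uT).
  by apply: (unique_solution hT hA hphi hpsi part hX reg M0 AM short uQ cf cz ez cx ex _ uT);
    rewrite Bz Bx.
apply: ge_sup; first by exists `|y 0|, 0 => //=; rewrite in_itv/= lexx ltW.
move=> z [u uI <-{z}]; have uT : 0 <= u <= T by move: uI; rewrite /= in_itv.
rewrite (yx u uT).
have [r rm ru] := partition_cover part hT uT; rewrite (xp r u rm ru).
apply: hK => //.
- by rewrite le_max normr_ge0 orbT.
- by move=> v vT; rewrite le_max norm1_bound.
- by rewrite le_max lexx orbT.
Qed.

End A_priori_bound.

Theorem theorem2p2 (R : realType) (n k q : nat) (T : R)
    (A : R -> 'M[R]_n) (phi psi : 'I_k -> R -> 'M[R]_n)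
    (s : 'I_q -> R) (B : 'I_q -> 'M[R]_n)
    (hn : (0 < n)%N) (hk : (0 < k)%N) (hT : 0 < T)
    (hA : {within `[0, T], continuous A})
    (hphi : forall j, {within `[0, T], continuous (phi j)})
    (hpsi : forall j, {within `[0, T], continuous (psi j)})
    (hs : forall l, 0 <= s l <= T)
    (hs0 : exists l, s l = 0) (hsT : exists l, s l = T) :
  well_posed T A phi psi s B <->
  (forall (m : nat) (t : nat -> R) (X : nat -> R -> 'M[R]_n),
     is_partition T s m t ->
     (forall r, (r < m)%N -> is_fundamental A (t r) (t r.+1) (X r)) ->
     regular phi psi m t X ->
     Qmx A phi psi s B m t X \in unitmx).
Proof.
split=> [wp m t X part hX reg|hQ].
  exact: (well_posed_Qmx_unit hT hA hphi hpsi part hX hs reg wp).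
have [m [t [X [M [part hX reg [M0 AM] short]]]]] := regular_partition hT hA hphi hpsi hs.
exact: (Qmx_unit_well_posed hT hA hphi hpsi hs part hX reg M0 AM short (hQ m t X part hX reg)).
Qed.
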